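(* Let $d\ge2$ be a constant and $\phi\ge1$. Starting with an arbitrary tour, the expected number of steps performed by 2-Opt on $\phi$-perturbed Euclidean instances with $n$ vertices is $O(n^7\cdot\log^2(n)\cdot\phi^3)$.
   Context: A $\phi$-perturbed Euclidean instance: vertices $v_1,\ldots,v_n$ are placed independently in $[0,1]^d$, vertex $v_i$ according to a density $f_i\colon[0,1]^d\to[0,\phi]$, with $L_2$ distances. 2-Opt repeatedly performs improving 2-changes (replace tour edges $\{u_1,u_2\},\{v_1,v_2\}$, with $u_1,u_2,v_1,v_2$ distinct and in this order along the tour, by $\{u_1,v_1\},\{u_2,v_2\}$, provided the tour length strictly decreases) until none exists; the bound holds for any initial tour and any choice of improving steps. $O$-notation hides constants depending on $d$. *)

(* Defs.v *)
From HB Require Import structures.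
From mathcomp Require Import all_boot all_order all_algebra.
From mathcomp Require Import all_classical all_reals all_analysis.

Set Implicit Arguments.
Unset Strict Implicit.
Unset Printing Implicit Defensive.

Import Order.TTheory GRing.Theory Num.Theory.
Import numFieldNormedType.Exports.

Local Open Scope classical_set_scope.
Local Open Scope ring_scope.

(* The product sigma-algebra on tuples over [measurableTypeR R] is the Borel
   sigma-algebra of R^d. *)
Notation Rpoint R d := (d.-tuple (measurableTypeR R)).

Section lebesgue_tuple.
Context {R : realType}.

Definition pcons d (z : measurableTypeR R * Rpoint R d) : Rpoint R d.+1 :=
  [tuple of z.1 :: z.2].

Lemma measurable_pcons d : measurable_fun [set: _] (@pcons d).
Proof. exact: measurable_cons. Qed.

Section lebesgue_cons.
Variables (d : nat) (mu : {sigma_finite_measure set (Rpoint R d) -> \bar R}).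

Definition lebesgue_cons : set (Rpoint R d.+1) -> \bar R :=
  pushforward (@lebesgue_measure R \x mu)%E (@pcons d).

Let lebesgue_cons0 : lebesgue_cons set0 = 0%E.
Proof. by rewrite /lebesgue_cons /pushforward preimage_set0 measure0. Qed.

Let lebesgue_cons_ge0 A : (0 <= lebesgue_cons A)%E.
Proof. exact: (measure_ge0 (@lebesgue_measure R \x mu)%E). Qed.

Let lebesgue_cons_sigma_additive : semi_sigma_additive lebesgue_cons.
Proof.
exact: (@measure_semi_sigma_additive _ _ _
  (measure_function_pushforward__canonical__measure_function_Measure
     (@lebesgue_measure R \x mu)%E (@measurable_pcons d))).
Qed.

HB.instance Definition _ := isMeasure.Build _ _ _ lebesgue_cons
  lebesgue_cons0 lebesgue_cons_ge0 lebesgue_cons_sigma_additive.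

Let lebesgue_cons_sigma_finite : sigma_finite [set: Rpoint R d.+1] lebesgue_cons.
Proof.
have /sigma_finiteP[F [TF ndF Foo]] := sigma_finiteT (@lebesgue_measure R).
have /sigma_finiteP[G [TG ndG Goo]] := sigma_finiteT mu.
pose uncons (t : Rpoint R d.+1) : measurableTypeR R * Rpoint R d :=
  (tnth t ord0, [tuple of behead t]).
have unconsK : cancel (@pcons d) uncons.
  by move=> [x t]; congr pair; apply/val_inj.
have muncons : measurable_fun [set: _] uncons.
  apply: measurable_fun_pair; first exact: measurable_tnth.
  exact: measurable_behead.
exists (fun k => uncons @^-1` (F k `*` G k)).
  rewrite -preimage_bigcup; apply/esym/seteqP; split => // t _.
  have [i _ Fi] : (\bigcup_i F i) (uncons t).1 by rewrite -TF.
  have [j _ Gj] : (\bigcup_i G i) (uncons t).2 by rewrite -TG.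
  exists (maxn i j) => //; split.
  - by move: Fi; exact/subsetPset/ndF/leq_maxl.
  - by move: Gj; exact/subsetPset/ndG/leq_maxr.
move=> k; have [mFk Fkoo] := Foo k; have [mGk Gkoo] := Goo k; split.
  by rewrite -[X in measurable X]setTI; apply: muncons => //; exact: measurableX.
rewrite /lebesgue_cons /pushforward -comp_preimage.
rewrite (_ : uncons \o _ = id) ?preimage_id; last exact/funext.
by rewrite product_measure1E// lte_mul_pinfty// ge0_fin_numE.
Qed.

HB.instance Definition _ := Measure_isSigmaFinite.Build _ _ _ lebesgue_cons
  lebesgue_cons_sigma_finite.

End lebesgue_cons.

(* d-dimensional Lebesgue measure on the Borel sets of R^d, as the iterated
   product of the one-dimensional one; R^0 carries the unit mass. *)
Fixpoint lebesgue_tuple d : {sigma_finite_measure set (Rpoint R d) -> \bar R} :=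
  if d is d'.+1 then lebesgue_cons (lebesgue_tuple d') else \d_[tuple].

End lebesgue_tuple.

Section two_opt.
Context {R : realType} {n d : nat}.

Definition dist2 (p q : Rpoint R d) : R :=
  Num.sqrt (\sum_(j < d) ((tnth p j : R) - tnth q j) ^+ 2).

(* A tour lists the n vertices in visiting order; it is read cyclically, so
   [next t u] is the vertex visited after u. *)
Record tour : Type := Tour {
  tour_tuple :> n.-tuple 'I_n;
  tour_uniq : uniq tour_tuple }.

Definition tour_edges (t : tour) : {set {set 'I_n}} :=
  [set [set u; next t u] | u : 'I_n]%SET.

Definition tour_length (x : 'I_n -> Rpoint R d) (t : tour) : R :=
  \sum_(u < n) dist2 (x u) (x (next t u)).

(* For distinct vertices with [next t u1 = u2] and [next t v1 = v2], the order
   along t is u1, u2, v1, v2.  As t' is constrained only through its set of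
   edges, nothing depends on the starting point or the orientation of its
   visiting order. *)
Definition two_change (t t' : tour) : bool :=
  [exists u1, exists u2, exists v1, exists v2,
    [&& uniq [:: u1; u2; v1; v2], next t u1 == u2, next t v1 == v2 &
        tour_edges t' ==
          tour_edges t :\: [set [set u1; u2]; [set v1; v2]]
            :|: [set [set u1; v1]; [set u2; v2]]]]%SET.

Definition improving (x : 'I_n -> Rpoint R d) : rel tour :=
  fun t t' => two_change t t' && (tour_length x t' < tour_length x t).

Definition locally_optimal (x : 'I_n -> Rpoint R d) (t : tour) : Prop :=
  forall t', ~~ improving x t t'.

(* r lists the tours visited after t, so the run performs [size r] steps. *)
Definition two_opt_run (x : 'I_n -> Rpoint R d) (t : tour) (r : seq tour) : Prop :=
  path (improving x) t r /\ locally_optimal x (last t r).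

(* Worst case over the initial tour and over all choices of improving steps. *)
Definition two_opt_steps (x : 'I_n -> Rpoint R d) : \bar R :=
  ereal_sup [set s | exists t r, two_opt_run x t r /\ s = (size r)%:R%:E].

End two_opt.

Section perturbed.
Context {R : realType} {n d : nat} {disp : measure_display}
  {Omega : measurableType disp} (P : probability Omega R).

Definition unit_cube : set (Rpoint R d) :=
  [set p | forall j, 0 <= (tnth p j : R) <= 1].

Definition mutually_independent (X : 'I_n -> {RV P >-> Rpoint R d}) : Prop :=
  forall (J : {set 'I_n}) (A : 'I_n -> set (Rpoint R d)),
    (forall i, measurable (A i)) ->
    P (\bigcap_(i in [set` J]) (X i @^-1` A i)) =
    (\prod_(i in J) P (X i @^-1` A i))%E.

Definition has_density (X : {RV P >-> Rpoint R d}) (f : Rpoint R d -> R) : Prop :=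
  forall A, measurable A ->
    distribution P X A =
    (\int[lebesgue_tuple d]_(p in A `&` unit_cube) (f p)%:E)%E.

(* The values of f i outside the unit cube are irrelevant. *)
Definition perturbed_instance (phi : R) (f : 'I_n -> Rpoint R d -> R)
    (X : 'I_n -> {RV P >-> Rpoint R d}) : Prop :=
  [/\ forall i, measurable_fun unit_cube (f i : _ -> measurableTypeR R),
      forall i p, unit_cube p -> 0 <= f i p <= phi,
      forall i, has_density (X i) (f i) &
      mutually_independent X].

End perturbed.

(* Main.v *)
(* A 2-change on u1, u2, v1, v2 gains F(u1) - F(v2), where
   F(x) = |x - u2| - |x - v1|.  For fixed u2 and v1 at distance about rho, move x
   along a line orthogonal to u2 - v1: there |x - u2|^2 - |x - v1|^2 is constant
   and F is monotone on either side of the foot of u2, with slope controlled by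
   an explicit weight V(x).  Level sets of F of width eps meet {V >= m} in measure
   O(eps / (rho m)), and {V <= v} has measure O(v).  Comparing V(u1) with V(v2)
   bounds the probability of a gain in (0, eps] by O(phi^2 eps log(1/eps) / rho);
   averaging over u2 removes 1 / rho and costs one more factor phi.  A run with k
   steps starts at length at most L = n sqrt(d), so for every t <= k some 2-change
   gains at most L / t.  Summing over the n^4 quadruples and over
   t <= n^n, which bounds the number of steps, gives
   n^5 phi^3 log(n^n)^2. *)

Require Import Defs.
From mathcomp Require Import all_boot all_order all_algebra.
From mathcomp Require Import all_classical all_reals all_analysis.
From mathcomp Require Import measurable_realfun ring lra.

Set Implicit Arguments.
Unset Strict Implicit.
Unset Printing Implicit Defensive.

Import Order.TTheory GRing.Theory Num.Theory.
Import numFieldNormedType.Exports.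

Local Open Scope classical_set_scope.
Local Open Scope ring_scope.

(** * Comparison of integrals *)

Section integral_comparison.
Local Open Scope ereal_scope.
Context {disp : measure_display} {T : measurableType disp} {R : realType}.
Implicit Types (mu : {measure set T -> \bar R}) (f g : T -> \bar R) (D : set T).

(* Integrals of nonnegative functions are suprema over simple functions, hence
   monotone even for nonmeasurable integrands. *)
Lemma ge0_le_nonmeasurable_integral mu D f g : (forall x, D x -> 0 <= f x) ->
  (forall x, D x -> f x <= g x) ->
  \int[mu]_(x in D) f x <= \int[mu]_(x in D) g x.
Proof.
move=> f0 fg; have g0 x : D x -> 0 <= g x.
  by move=> Dx; apply: le_trans (fg x Dx); exact: f0.
rewrite !ge0_integralE//; apply: ge_ereal_sup => _ [h /= hf <-].
apply: ereal_sup_ubound; exists h => // x; apply: (le_trans (hf x)).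
exact: lee_restrict.
Qed.

Lemma integral_le_ge0 mu f g : (forall x, 0 <= g x) -> (forall x, f x <= g x) ->
  \int[mu]_x f x <= \int[mu]_x g x.
Proof.
move=> g0 fg; apply: (@le_trans _ _ (\int[mu]_x f^\+ x)).
  by rewrite integralE -[leRHS]sube0 leeB// integral_ge0.
apply: ge0_le_nonmeasurable_integral => // x _.
by rewrite funeposE ge_max fg g0.
Qed.

Lemma ae_le_ge0_integral mu f g : measurable_fun setT g ->
  (forall x, 0 <= g x) -> {ae mu, forall x, f x <= g x} ->
  \int[mu]_x f x <= \int[mu]_x g x.
Proof.
move=> mg g0 [N [mN muN0 fgN]].
have ind0 x : 0 <= (\1_N x)%:E :> \bar R by rewrite lee_fin.
have mind : measurable_fun setT (fun x => (\1_N x)%:E : \bar R).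
  exact/measurable_EFinP/measurable_indic.
apply: (@le_trans _ _ (\int[mu]_x (g x + +oo * (\1_N x)%:E))).
  apply: integral_le_ge0 => x; first by rewrite adde_ge0 ?mule_ge0 ?leey.
  have [Nx|Nx] := pselect (N x); rewrite indicE.
    by rewrite mem_set// mule1 addey ?leey// gt_eqF// (lt_le_trans _ (g0 x)) ?ltNyr.
  by rewrite memNset// mule0 adde0; apply: contrapT => /fgN.
rewrite ge0_integralD//; last exact: measurable_funeM.
by rewrite ge0_integralZl ?leey// integral_indic// setIT (_ : mu N = 0)// mule0 adde0.
Qed.

Lemma ge0_integral_le_cst mu D f (M : \bar R) : measurable D -> 0 <= M ->
  (forall x, D x -> 0 <= f x <= M) -> \int[mu]_(x in D) f x <= M * mu D.
Proof.
move=> mD M0 fM; rewrite -integral_cst//.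
by apply: ge0_le_nonmeasurable_integral => x /fM/andP[].
Qed.

Lemma integral_support mu D f : (forall x, ~ D x -> f x = 0) ->
  \int[mu]_(x in D) f x = \int[mu]_x f x.
Proof.
move=> fD; rewrite integral_mkcond; apply: eq_integral => x _; rewrite patchE.
by case: ifPn => // /negP Dx; rewrite fD// => /mem_set.
Qed.

Lemma integral_indicT mu D : measurable D -> \int[mu]_x (\1_D x)%:E = mu D.
Proof. by move=> mD; rewrite integral_indic// setIT. Qed.

End integral_comparison.

Lemma measurable_preimageT {d1 d2 : measure_display} {T1 : measurableType d1}
    {T2 : measurableType d2} (f : T1 -> T2) (Y : set T2) :
  measurable_fun setT f -> measurable Y -> measurable (f @^-1` Y).
Proof. by move=> mf mY; rewrite -[X in measurable X]setTI; exact: mf. Qed.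

Section density_le.
Local Open Scope ereal_scope.
Context {R : realType}.

Definition density_le {disp : measure_display} {T : measurableType disp} (c : R)
    (m nu : set T -> \bar R) :=
  forall A, measurable A -> m A <= c%:E * nu A.

Lemma density_le_integral {disp : measure_display} {T : measurableType disp}
    (c : R) (m nu : {measure set T -> \bar R}) (h : T -> \bar R) :
  (0 <= c)%R -> density_le c m nu -> measurable_fun setT h ->
  (forall x, 0 <= h x) -> \int[m]_x h x <= c%:E * \int[nu]_x h x.
Proof.
move=> c0 mnu mh h0; rewrite -(@ge0_integral_mscale _ _ _ _ setT _ (NngNum c0))//.
exact: ge0_le_measure_integral.
Qed.

Lemma density_le_prod {d1 d2 : measure_display} {T1 : measurableType d1}
    {T2 : measurableType d2} (c1 c2 : R) (m1 nu1 : {measure set T1 -> \bar R})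
    (m2 nu2 : {sigma_finite_measure set T2 -> \bar R}) :
  (0 <= c1)%R -> (0 <= c2)%R -> density_le c1 m1 nu1 -> density_le c2 m2 nu2 ->
  density_le (c1 * c2) (m1 \x m2) (nu1 \x nu2).
Proof.
move=> c10 c20 m1nu1 m2nu2 A mA.
have mxA := measurable_fun_xsection nu2 mA.
apply: (@le_trans _ _ (\int[m1]_x (c2%:E * nu2 (xsection A x)))).
  apply: ge0_le_nonmeasurable_integral => // x _ /=.
  exact/m2nu2/measurable_xsection.
rewrite ge0_integralZl ?lee_fin// (mulrC c1) EFinM -muleA lee_wpmul2l ?lee_fin//.
exact: density_le_integral.
Qed.

End density_le.

(** * Lebesgue measure on the line and in the plane *)

Section measure_preserving.
Local Open Scope ereal_scope.
Context {d1 d2 : measure_display} {T1 : measurableType d1}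
  {T2 : measurableType d2} {R : realType}.

Lemma ge0_integral_measure_preserving (m1 : {measure set T1 -> \bar R})
    (m2 : {measure set T2 -> \bar R}) (phi : T1 -> T2) (f : T2 -> \bar R) :
  measurable_fun setT phi ->
  (forall A, measurable A -> pushforward m1 phi A = m2 A) ->
  measurable_fun setT f -> (forall y, 0 <= f y) ->
  \int[m1]_x f (phi x) = \int[m2]_y f y.
Proof.
move=> mphi phiE mf f0.
transitivity (\int[pushforward m1 phi]_y f y).
  by rewrite (ge0_integral_pushforward mphi)// preimage_setT.
by apply: (eq_measure_integral m2) => // A mA _; exact: phiE.
Qed.

End measure_preserving.

Section line.
Context {R : realType}.
Local Notation mR := (measurableTypeR R).
Local Notation leb := (@lebesgue_measure R).

Lemma lebesgue_measure_itvcc (a b : R) : a <= b ->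
  leb `[a, b]%classic = (b - a)%:E.
Proof.
rewrite lebesgue_measure_itv/= lte_fin le_eqVlt => /orP[/eqP->|->//].
by rewrite ltxx subrr.
Qed.

Lemma lebesgue_measureB (c : R) (A : set R) : measurable A ->
  pushforward leb ((fun x => x - c) : _ -> mR) A = leb A.
Proof.
move=> mA.
have mB : measurable_fun setT (fun x : mR => x - c : mR) by exact: measurable_funB.
apply/esym/lebesgue_measure_unique => //= _ [[a b]] _ <-.
rewrite /pushforward.
have -> : (fun x : mR => x - c) @^-1` `]a, b] = `]a + c, b + c]%classic.
  by apply/seteqP; split => x /=; rewrite !in_itv/= ltrBrDr lerBlDr.
rewrite !lebesgue_measure_itv/= !lte_fin ltrD2r.
by case: ifP => // _; rewrite -!EFinB; congr EFin; ring.
Qed.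

Lemma lebesgue_diameter_le (E : set R) (delta : R) : measurable E ->
  0 <= delta -> (forall s s', E s -> E s' -> s' - s <= delta) ->
  (leb E <= delta%:E)%E.
Proof.
move=> mE d0 dE; have [->|/set0P[s0 Es0]] := eqVneq E set0.
  by rewrite measure0 lee_fin.
have lbE s : E s -> lbound E (s - delta).
  by move=> Es s' Es'; have := dE _ _ Es' Es; lra.
rewrite -[leRHS](_ : leb `[inf E, inf E + delta]%classic = _); last first.
  by rewrite lebesgue_measure_itvcc ?lerDl// addrAC subrr add0r.
apply: le_measure; rewrite ?inE// => s Es /=; rewrite in_itv/=.
apply/andP; split; first by apply: ge_inf => //; exists (s0 - delta); exact: lbE.
by rewrite -lerBlDr; apply: lb_le_inf; [exists s0|exact: lbE].
Qed.

Lemma lebesgue_radial_diameter_le (E : set R) (sigma delta : R) :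
  measurable E -> 0 <= delta ->
  (forall s s', E s -> E s' -> `|s' - sigma| - `|s - sigma| <= delta) ->
  (leb E <= (2 * delta)%:E)%E.
Proof.
move=> mE d0 dE.
have mEr : measurable (E `&` `[sigma, +oo[) by exact: measurableI.
have mEl : measurable (E `&` `]-oo, sigma]) by exact: measurableI.
rewrite (_ : E = (E `&` `[sigma, +oo[) `|` (E `&` `]-oo, sigma])); last first.
  rewrite -setIUr; apply/esym/setIidPl => s _ /=; rewrite !in_itv/= andbT.
  exact/orP/le_total.
rewrite mulr_natl mulr2n EFinD; apply: (le_trans (measureU2 _ _ _)) => //.
apply: leeD; apply: lebesgue_diameter_le => // s s' [Es] /=; rewrite in_itv/= ?andbT.
  move=> s_ge [Es' /=]; rewrite in_itv/= andbT => s'_ge.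
  by have := dE s s' Es Es'; rewrite !ger0_norm ?subr_ge0//; lra.
move=> s_le [Es' /=]; rewrite in_itv/= => s'_le.
by have := dE s' s Es' Es; rewrite !ler0_norm ?subr_le0//; lra.
Qed.

End line.

Section inv_sqrt.
Context {R : realType}.
Local Notation mR := (measurableTypeR R).
Local Notation leb := (@lebesgue_measure R).

Definition inv_sqrt (u : R) : \bar R := ((Num.sqrt `|u|)%:E^-1)%E.

Lemma inv_sqrt0 : inv_sqrt 0 = +oo%E.
Proof. by rewrite /inv_sqrt normr0 sqrtr0 inve0. Qed.

Lemma inv_sqrtE u : u != 0 -> inv_sqrt u = ((Num.sqrt `|u|)^-1)%:E.
Proof.
by move=> u0; rewrite /inv_sqrt inver gt_eqF// sqrtr_gt0 normr_gt0.
Qed.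

Lemma inv_sqrt_gt0 u : (0 < inv_sqrt u)%E.
Proof.
have [->|u0] := eqVneq u 0; first by rewrite inv_sqrt0.
by rewrite inv_sqrtE// lte_fin invr_gt0 sqrtr_gt0 normr_gt0.
Qed.

Lemma inv_sqrt_ge0 u : (0 <= inv_sqrt u)%E.
Proof. exact/ltW/inv_sqrt_gt0. Qed.

Lemma inv_sqrtN u : inv_sqrt (- u) = inv_sqrt u.
Proof. by rewrite /inv_sqrt normrN. Qed.

Lemma measurable_inv_sqrt : measurable_fun setT (inv_sqrt : mR -> \bar R).
Proof.
rewrite (_ : inv_sqrt = fun u =>
    if u == 0 then +oo%E else ((`|u| `^ (- 2^-1))%:E)%E); last first.
  apply/funext => u; case: ifPn => [/eqP->|/inv_sqrtE->]; first exact: inv_sqrt0.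
  by rewrite powRN powR12_sqrt.
apply: measurable_fun_ifT => //; first exact: measurable_fun_eqr.
apply/measurable_EFinP.
exact: (measurableT_comp (measurable_powR (- 2^-1)) (@normr_measurable R setT)).
Qed.

Lemma measurable_inv_sqrt_shift (x0 : R) :
  measurable_fun setT (fun x : mR => inv_sqrt (x - x0)).
Proof. by apply: (measurableT_comp measurable_inv_sqrt); exact: measurable_funB. Qed.

Lemma integral_inv_sqrt_itv (a b : R) : 0 < a -> a <= b ->
  (\int[leb]_(x in `[a, b]%classic) inv_sqrt x)%E =
  (2 * (Num.sqrt b - Num.sqrt a))%:E.
Proof.
move=> a0; rewrite le_eqVlt => /predU1P[<-|ab].
  by rewrite set_itv1 integral_set1 subrr mulr0.
transitivity (\int[leb]_(x in `[a, b]) ((Num.sqrt x)^-1)%:E)%E.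
  apply: eq_integral => x /set_mem/=; rewrite in_itv/= => /andP[ax _].
  have x0 := lt_le_trans a0 ax.
  by rewrite inv_sqrtE ?gt_eqF// gtr0_norm.
rewrite (@continuous_FTC2 _ _ (fun x => 2 * Num.sqrt x) _ _ ab).
- by rewrite -EFinB mulrBr.
- apply: continuous_in_subspaceT => x /set_mem/=; rewrite in_itv/= => /andP[ax _].
  apply: continuousV; last exact: sqrt_continuous.
  by rewrite gt_eqF// sqrtr_gt0 (lt_le_trans a0).
- split.
  + move=> x; rewrite in_itv/= => /andP[ax _].
    apply: derivableM => //.
    by have [] := is_derive1_sqrt (lt_trans a0 ax).
  + by apply: cvg_at_right_filter; apply: cvgZr; exact: sqrt_continuous.
  + by apply: cvg_at_left_filter; apply: cvgZr; exact: sqrt_continuous.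
- move=> x; rewrite in_itv/= => /andP[/(lt_trans a0) x0 _].
  rewrite derive1E deriveZ//=; last by have [] := is_derive1_sqrt x0.
  by rewrite derive_sqrt// /GRing.scale/= invfM mulrA mulfV// mul1r.
Qed.

Lemma integral_inv_sqrt_01 :
  (\int[leb]_(x in `[0%R, 1%R]%classic) inv_sqrt x <= 2%:E)%E.
Proof.
rewrite -integral_itv_obnd_cbnd; last exact: (measurable_funTS measurable_inv_sqrt).
rewrite itv_open_bnd_bigcup.
apply: (@cvge_le _ \oo); last apply: ge0_nondecreasing_set_cvg_integral => //=.
- apply: nearW => n; rewrite add0r integral_inv_sqrt_itv ?invr_gt0//; last first.
    by rewrite invf_le1 ?ler1n.
  by rewrite lee_fin sqrtr1 ler_piMr// lerBlDr lerDl sqrtr_ge0.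
- apply/nondecreasing_seqP => n; rewrite subsetEset => x /=; rewrite !in_itv/=.
  case/andP => h ->; rewrite andbT (le_trans _ h)// lerD2l lef_pV2 ?posrE//.
  by rewrite ler_nat.
- by move=> n; exact: (measurable_funTS measurable_inv_sqrt).
- by move=> n x _; exact: inv_sqrt_ge0.
Qed.

Let inv_sqrt01 : mR -> \bar R := inv_sqrt \_ `[0, 1]%classic.

Let inv_sqrt01_ge0 x : (0 <= inv_sqrt01 x)%E.
Proof. by apply: erestrict_ge0 => *; exact: inv_sqrt_ge0. Qed.

Let measurable_inv_sqrt01 : measurable_fun setT inv_sqrt01.
Proof.
apply/(measurable_restrictT _ _).1; first exact: measurable_itv.
exact: (measurable_funTS measurable_inv_sqrt).
Qed.

Let inv_sqrt_le01 u : (inv_sqrt u <= 1 + (inv_sqrt01 u + inv_sqrt01 (- u)%R))%E.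
Proof.
have [u1|u1] := leP `|u| 1; last first.
  apply: (@le_trans _ _ 1%E); last by rewrite leeDl// adde_ge0.
  have u0 : u != 0 by rewrite -normr_gt0 (lt_trans _ u1).
  rewrite inv_sqrtE// lee_fin invf_le1 ?sqrtr_gt0 ?normr_gt0//.
  by rewrite -[leLHS]sqrtr1 ler_wsqrtr// ltW.
apply: (@le_trans _ _ (inv_sqrt01 u + inv_sqrt01 (- u)%R)%E); last by rewrite leeDr.
move: u1; rewrite ler_norml => /andP[u1 u1']; have [u0|/ltW u0] := leP 0 u.
  by rewrite [inv_sqrt01 u]patchE mem_set ?leeDl//= in_itv/= u0.
rewrite [inv_sqrt01 (- u)]patchE mem_set ?inv_sqrtN ?leeDr//= in_itv/=.
by rewrite oppr_ge0 u0 lerNl.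
Qed.

Lemma integral_inv_sqrt_shift_le (x0 a b : R) : a <= b ->
  (\int[leb]_(x in `[a, b]%classic) inv_sqrt (x - x0)%R <= (b - a + 4)%:E)%E.
Proof.
move=> ab; pose g u := (inv_sqrt01 u + inv_sqrt01 (- u)%R)%E.
have mN : measurable_fun setT (-%R : mR -> mR) by exact: oppr_measurable.
have mB : measurable_fun setT (fun x : mR => x - x0 : mR) by exact: measurable_funB.
have mgN : measurable_fun setT (fun u : mR => inv_sqrt01 (- u)).
  exact: measurableT_comp.
have g0 u : (0 <= g u)%E by rewrite adde_ge0.
have mg : measurable_fun setT (g : mR -> \bar R) by exact: emeasurable_funD.
have mgB : measurable_fun setT (fun x : mR => g (x - x0)) by exact: measurableT_comp.
have intg : (\int[leb]_u g u <= 4%:E)%E.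
  rewrite ge0_integralD// (ge0_integral_measure_preserving mN (@lebesgue_measureN R))//.
  rewrite -integral_mkcond (_ : 4 = 2 + 2 :> R); last by ring.
  by rewrite EFinD leeD// integral_inv_sqrt_01.
apply: (@le_trans _ _ (\int[leb]_(x in `[a, b]) (1 + g (x - x0)%R))%E).
  apply: ge0_le_nonmeasurable_integral => x _; first exact: inv_sqrt_ge0.
  exact: inv_sqrt_le01.
rewrite ge0_integralD//; last exact: measurable_funTS.
rewrite EFinD; apply: leeD.
  by rewrite integral_cst//= mul1e lebesgue_measure_itvcc.
apply: (@le_trans _ _ (\int[leb]_x g (x - x0)%R)%E).
  by apply: ge0_subset_integral.
by rewrite (ge0_integral_measure_preserving mB (lebesgue_measureB x0)).
Qed.

End inv_sqrt.

Section product_measure.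
Local Open Scope ereal_scope.
Context {d1 d2 : measure_display} {T1 : measurableType d1}
  {T2 : measurableType d2} {R : realType}.

Lemma product_measure12E (m1 : {sigma_finite_measure set T1 -> \bar R})
    (m2 : {sigma_finite_measure set T2 -> \bar R}) (S : set (T1 * T2)) :
  measurable S -> (m1 \x m2) S = (m1 \x^ m2) S.
Proof.
by move: S; apply: product_measure_unique => //= *; rewrite product_measure2E.
Qed.

Lemma product_measureC (m1 : {sigma_finite_measure set T1 -> \bar R})
    (m2 : {sigma_finite_measure set T2 -> \bar R}) (S : set (T1 * T2)) :
  measurable S -> (m1 \x m2) S = (m2 \x m1) [set z | S (z.2, z.1)].
Proof. by move=> mS; rewrite product_measure12E//; exact: eq_integral. Qed.

End product_measure.

Section plane.
Context {R : realType}.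
Local Notation mR := (measurableTypeR R).
Local Notation leb := (@lebesgue_measure R).
Local Notation plane := (mR * mR)%type.

Definition unit_square : set plane := `[0, 1]%classic `*` `[0, 1]%classic.

Definition line_point (w xi s : R) : plane := (xi - w * s, s).

Lemma measurable_line_point (w xi : R) :
  measurable_fun setT (line_point w xi : mR -> plane).
Proof.
apply: measurable_fun_pair => //.
by apply: measurable_funB => //; exact: measurable_funM.
Qed.

Lemma measurable_line_section (w xi : R) (S : set plane) : measurable S ->
  measurable [set s : mR | S (line_point w xi s)].
Proof.
by move=> mS; exact: measurable_preimageT (measurable_line_point w xi) mS.
Qed.

(* Shearing z into (z.1 - w * z.2, z.2) preserves the measure, since it
   translates every horizontal line. *)
Lemma product_lebesgue_shear (w : R) (S : set plane) : measurable S ->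
  (leb \x leb)%E S = (\int[leb]_xi leb [set s : mR | S (line_point w xi s)])%E.
Proof.
move=> mS; pose S' := [set z : plane | S (line_point w z.1 z.2)].
have mS' : measurable S'.
  apply: measurable_preimageT mS.
  apply: (measurable_fun_pair (f := fun z : plane => z.1 - w * z.2 : mR)) => //.
  by apply: measurable_funB => //; exact: measurable_funM.
transitivity ((leb \x leb)%E S'); last first.
  by apply: eq_integral => xi _ /=; congr (leb _); rewrite xsectionE.
rewrite !product_measure12E//; apply: eq_integral => s _ /=.
rewrite -(lebesgue_measureB (w * s)); last exact: measurable_ysection.
by rewrite !ysectionE.
Qed.

Lemma product_lebesgue_shear_le (S : set plane) (w c xi0 : R) :
  measurable S -> S `<=` unit_square -> `|w| <= 1 -> 0 < c ->
  (forall xi, xi != xi0 ->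
    leb [set s : mR | S (line_point w xi s)] <= c%:E * inv_sqrt (xi - xi0)%R)%E ->
  ((leb \x leb) S <= (7 * c)%:E)%E.
Proof.
move=> mS S01 w1 c0 Sc; rewrite (product_lebesgue_shear w)//.
apply: (@le_trans _ _ (\int[leb]_(xi in `[(- 1)%R, 2%R]%classic)
    (c%:E * inv_sqrt (xi - xi0)%R))%E).
  rewrite [leRHS]integral_mkcond; apply: ge0_le_nonmeasurable_integral => // xi _.
  rewrite patchE; case: ifPn => [_|].
    have [->|xi0xi] := eqVneq (xi : R) xi0; last exact: Sc.
    by rewrite subrr inv_sqrt0 gt0_muley ?lte_fin// leey.
  rewrite mem_setE in_itv/= => /negP xiN.
  rewrite (_ : [set _ | _] = set0) ?measure0//.
  apply/seteqP; split => // s /= /S01[/=]; rewrite !in_itv/= => /andP[? ?] /andP[? ?].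
  apply: xiN; move: w1; rewrite ler_norml => /andP[? ?]; apply/andP; split; nra.
rewrite ge0_integralZl//; last 3 first.
- exact: (measurable_funTS (measurable_inv_sqrt_shift xi0)).
- by move=> x _; exact: inv_sqrt_ge0.
- by rewrite lee_fin ltW.
rewrite (mulrC 7) EFinM lee_wpmul2l ?lee_fin ?(ltW c0)//.
apply: (le_trans (integral_inv_sqrt_shift_le _ _)); first by lra.
by rewrite lee_fin; lra.
Qed.

End plane.

(** * Level sets of a difference of two distances *)

(* Rationalise: p - q = (p ^+ 2 - q ^+ 2) / (p + q), where the numerator is the
   same for both pairs. *)
Lemma root_difference_gap (R : realFieldType) (p q p' q' L : R) :
  0 <= p <= L -> 0 <= q <= L -> 0 <= p' <= L -> 0 <= q' <= L ->
  p' ^+ 2 - q' ^+ 2 = p ^+ 2 - q ^+ 2 -> p ^+ 2 <= p' ^+ 2 ->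
  `|p ^+ 2 - q ^+ 2| * (p' ^+ 2 - p ^+ 2) <=
  4 * L ^+ 3 * `|(p - q) - (p' - q')|.
Proof.
move=> /andP[p0 pL] /andP[q0 qL] /andP[p'0 p'L] /andP[q'0 q'L] eqD pp'.
set D := p ^+ 2 - q ^+ 2; set h := p' ^+ 2 - p ^+ 2; set delta := p - q - _.
have L0 : 0 <= L by exact: le_trans pL.
have le_pp' : p <= p' by rewrite -(@ler_pXn2r _ 2).
have le_qq' : q <= q' by rewrite -(@ler_pXn2r _ 2)//; move: eqD pp'; lra.
pose rise := (p' - p) + (q' - q).
have rise0 : 0 <= rise by rewrite addr_ge0// subr_ge0.
have h_rise : h <= L * rise.
  have h_le_p : h <= 2 * L * (p' - p) by rewrite /h subr_sqr; nra.
  have h_le_q : h <= 2 * L * (q' - q).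
    rewrite (_ : h = q' ^+ 2 - q ^+ 2); first by rewrite subr_sqr; nra.
    by rewrite /h; move: eqD; lra.
  by rewrite /rise mulrDr; lra.
have delta_rise : `|delta| * ((p + q) * (p' + q')) = `|D| * rise.
  rewrite -(ger0_norm rise0) -[X in _ * X = _]ger0_norm ?mulr_ge0 ?addr_ge0//.
  rewrite -!normrM; congr (`|_|).
  transitivity (D * (p' + q') - (p' ^+ 2 - q' ^+ 2) * (p + q)).
    by rewrite /delta /D; ring.
  by rewrite eqD -/D /rise; ring.
apply: (@le_trans _ _ (L * (`|delta| * ((p + q) * (p' + q'))))).
  by rewrite delta_rise mulrCA ler_wpM2l.
rewrite (_ : 4 * L ^+ 3 * _ = L * (`|delta| * ((L + L) * (L + L)))); last by ring.
by rewrite !(ler_wpM2l, ler_pM, lerD, addr_ge0).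
Qed.

Section plane_geometry.
Context {R : realType}.
Local Notation mR := (measurableTypeR R).
Local Notation leb := (@lebesgue_measure R).
Local Notation plane := (mR * mR)%type.
Implicit Types (a b z : plane) (A B D : R).

(* The offset A accounts for the coordinates transverse to the plane. *)
Definition offset_sqdist A a z : R := A + (z.1 - a.1) ^+ 2 + (z.2 - a.2) ^+ 2.

Definition offset_dist A a z : R := Num.sqrt (offset_sqdist A a z).

Definition max_dist a b : R := Num.max `|a.1 - b.1| `|a.2 - b.2|.

Definition cross a b z : R :=
  (a.1 - b.1) * (z.2 - a.2) - (a.2 - b.2) * (z.1 - a.1).

(* The derivative of |x - a| - |x - b| along the direction orthogonal to a - b
   vanishes where x is collinear with a and b and where x is equidistant from
   them; with D = |x - a| ^+ 2 - |x - b| ^+ 2 the weight measures the distance to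
   both degeneracies.  The exponents 1/2 and 1 are those for which the sublevel
   sets, and the level sets restricted to a superlevel set, both have linearly
   bounded measure. *)
Definition slope_weight D a b z : R :=
  Num.sqrt (`|D| / (2 * max_dist a b)) * (`|cross a b z| / max_dist a b).

Definition offset_dist_diff A B a b z : R := offset_dist A a z - offset_dist B b z.

Definition offset_weight A B a b z : R :=
  slope_weight (offset_sqdist A a z - offset_sqdist B b z) a b z.

Definition sqdists_le (L : R) A B a b z : Prop :=
  offset_sqdist A a z <= L ^+ 2 /\ offset_sqdist B b z <= L ^+ 2.

Lemma offset_sqdist_ge0 A a z : 0 <= A -> 0 <= offset_sqdist A a z.
Proof. by move=> A0; rewrite !addr_ge0// sqr_ge0. Qed.

Lemma offset_dist_itv A a z L : 0 <= L -> offset_sqdist A a z <= L ^+ 2 ->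
  0 <= offset_dist A a z <= L.
Proof.
move=> L0 zL; rewrite sqrtr_ge0/= -[leRHS](ger0_norm L0) -sqrtr_sqr.
exact: ler_wsqrtr.
Qed.

Section orthogonal_line.
Variables (A B : R) (a b : plane).
Hypotheses (ab1 : a.1 != b.1) (ab2 : `|a.2 - b.2| <= `|a.1 - b.1|).

Definition slope : R := (a.2 - b.2) / (a.1 - b.1).

Definition line_scale : R := 1 + slope ^+ 2.

(* The value of xi for which the line consists of points equidistant from a and b. *)
Definition equidistant_line : R :=
  (a.1 + b.1 + slope * (a.2 + b.2)) / 2 + (A - B) / (2 * (a.1 - b.1)).

(* The parameter s of the orthogonal projection of a onto the line xi. *)
Definition foot (xi : R) : R := (a.2 + slope * (xi - a.1)) / line_scale.

Local Notation on_line := (line_point slope).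
Local Notation F := (offset_dist_diff A B a b).
Local Notation V := (offset_weight A B a b).

Let scale_ge1 : 1 <= line_scale. Proof. by rewrite lerDl sqr_ge0. Qed.
Let scale_gt0 : 0 < line_scale. Proof. exact: lt_le_trans scale_ge1. Qed.
Let ab_neq0 : a.1 - b.1 != 0. Proof. by rewrite subr_eq0. Qed.
Let ab_gt0 : 0 < `|a.1 - b.1|. Proof. by rewrite normr_gt0. Qed.
Let ab2E : a.2 - b.2 = slope * (a.1 - b.1). Proof. by rewrite /slope divfK. Qed.
Let footE xi : line_scale * foot xi = a.2 + slope * (xi - a.1).
Proof. by rewrite /foot mulrC divfK// gt_eqF. Qed.

Lemma max_dist_fst : max_dist a b = `|a.1 - b.1|.
Proof. exact/max_idPl. Qed.

Lemma slope_le1 : `|slope| <= 1.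
Proof. by rewrite normrM normfV ler_pdivrMr// mul1r. Qed.

Lemma offset_sqdistB_line xi s :
  offset_sqdist A a (on_line xi s) - offset_sqdist B b (on_line xi s) =
  - (2 * (a.1 - b.1) * (xi - equidistant_line)).
Proof.
rewrite /offset_sqdist /equidistant_line /=.
have -> : b.2 = a.2 - slope * (a.1 - b.1) by rewrite -ab2E; ring.
by move: slope => w; field; exact: ab_neq0.
Qed.

Lemma cross_line xi s :
  cross a b (on_line xi s) = (a.1 - b.1) * line_scale * (s - foot xi).
Proof.
rewrite -mulrA mulrBr footE /cross /= ab2E /line_scale; ring.
Qed.

Lemma offset_sqdist_line_move xi s s' :
  offset_sqdist A a (on_line xi s') - offset_sqdist A a (on_line xi s) =
  line_scale * ((s' - foot xi) ^+ 2 - (s - foot xi) ^+ 2).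
Proof.
rewrite (_ : line_scale * _ = line_scale * (s' - s) * (s' + s)
  - 2 * (s' - s) * (line_scale * foot xi)); last by ring.
by rewrite footE /line_scale /offset_sqdist /=; ring.
Qed.

Lemma offset_weight_line xi s : V (on_line xi s) =
  Num.sqrt `|xi - equidistant_line| * (line_scale * `|s - foot xi|).
Proof.
rewrite /offset_weight /slope_weight max_dist_fst offset_sqdistB_line cross_line.
rewrite normrN !normrM (gtr0_norm scale_gt0) (ger0_norm (ler0n R 2)).
by congr (Num.sqrt _ * _); field; rewrite gt_eqF.
Qed.

Lemma line_sublevel_le (v : R) (E : set mR) (xi : R) : measurable E -> 0 <= v ->
  xi != equidistant_line ->
  (forall s, E s -> V (on_line xi s) <= v) ->
  (leb E <= (2 * v)%:E * inv_sqrt (xi - equidistant_line))%E.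
Proof.
move=> mE v0 xi_neq Ev; rewrite inv_sqrtE ?subr_eq0// -EFinM -mulrA.
set k := Num.sqrt _.
have k0 : 0 < k by rewrite sqrtr_gt0 normr_gt0 subr_eq0.
have foot_le s : E s -> `|s - foot xi| <= v / k.
  move=> /Ev; rewrite offset_weight_line -/k => /(le_trans _) weight_le.
  rewrite ler_pdivlMr// mulrC; apply: weight_le.
  by rewrite ler_wpM2l ?(ltW k0)// ler_peMl.
apply: (@lebesgue_radial_diameter_le _ _ (foot xi)) => //.
  by rewrite divr_ge0// ltW.
by move=> s s' _ /foot_le s'_le; rewrite lerBlDr (le_trans s'_le)// lerDl.
Qed.

Hypotheses (A0 : 0 <= A) (B0 : 0 <= B).

Lemma line_dist_gap (L xi s s' : R) : 0 <= L ->
  sqdists_le L A B a b (on_line xi s) -> sqdists_le L A B a b (on_line xi s') ->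
  `|s - foot xi| <= `|s' - foot xi| ->
  `|a.1 - b.1| * `|xi - equidistant_line| *
    (line_scale * (`|s' - foot xi| ^+ 2 - `|s - foot xi| ^+ 2)) <=
  2 * L ^+ 3 * `|F (on_line xi s) - F (on_line xi s')|.
Proof.
move=> L0 [sA sB] [s'A s'B] ss'.
have sqr_le : (s - foot xi) ^+ 2 <= (s' - foot xi) ^+ 2.
  by rewrite -![(_ - foot xi) ^+ 2]real_normK ?num_real// ler_pXn2r ?nnegrE.
have := @root_difference_gap _ _ _ _ _ L (offset_dist_itv L0 sA)
  (offset_dist_itv L0 sB) (offset_dist_itv L0 s'A) (offset_dist_itv L0 s'B).
rewrite !sqr_sqrtr ?offset_sqdist_ge0// !offset_sqdistB_line => /(_ erefl).
rewrite -subr_ge0 offset_sqdist_line_move => /(_ (mulr_ge0 (ltW scale_gt0) _)).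
rewrite subr_ge0 => /(_ sqr_le); rewrite normrN !normrM (ger0_norm (ler0n R 2)).
by rewrite -![(_ - foot xi) ^+ 2]real_normK ?num_real//; lra.
Qed.

Lemma line_weight_gap (L xi s s' : R) : 0 <= L ->
  sqdists_le L A B a b (on_line xi s) -> sqdists_le L A B a b (on_line xi s') ->
  `|s - foot xi| <= `|s' - foot xi| ->
  max_dist a b * Num.sqrt `|xi - equidistant_line| * V (on_line xi s) *
    (`|s' - foot xi| - `|s - foot xi|) <=
  L ^+ 3 * `|F (on_line xi s) - F (on_line xi s')|.
Proof.
move=> L0 sL s'L ss'; have := line_dist_gap L0 sL s'L ss'.
rewrite max_dist_fst offset_weight_line.
rewrite -[`|xi - equidistant_line| in X in X -> _]sqr_sqrtr//.
set k := Num.sqrt _; set u := `|s - foot xi|; set u' := `|s' - foot xi|.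
set rho := `|a.1 - b.1|; set dF := `|_ - _| => gap.
rewrite -(ler_pM2l (ltr0n R 2)) mulrA [leRHS]mulrA; apply: le_trans gap.
rewrite (_ : 2 * _ * _ = rho * k ^+ 2 * (line_scale * (2 * u * (u' - u)))); last first.
  by ring.
have rho0 : 0 <= rho by exact: normr_ge0.
apply: ler_wpM2l; first by rewrite mulr_ge0// sqr_ge0.
apply: ler_wpM2l; first exact: ltW.
by have := sqr_ge0 (u' - u); rewrite !expr2; lra.
Qed.

Lemma line_level_le (L y eps m : R) (E : set mR) (xi : R) : measurable E ->
  0 < eps -> 0 < m -> 0 <= L -> xi != equidistant_line ->
  (forall s, E s -> [/\ sqdists_le L A B a b (on_line xi s),
     y <= F (on_line xi s) <= y + eps &
     m <= V (on_line xi s)]) ->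
  (leb E <= (2 * (L ^+ 3 * eps / (max_dist a b * m)))%:E
    * inv_sqrt (xi - equidistant_line))%E.
Proof.
move=> mE eps0 m0 L0 xi_neq E_le.
rewrite inv_sqrtE ?subr_eq0// -EFinM -[2 * _ / _]mulrA.
set k := Num.sqrt _; set rho := max_dist a b; set delta := L ^+ 3 * eps / (rho * m) / k.
have k0 : 0 < k by rewrite sqrtr_gt0 normr_gt0 subr_eq0.
have rho0 : 0 < rho by rewrite /rho max_dist_fst.
have L30 : 0 <= L ^+ 3 by exact: exprn_ge0.
have delta0 : 0 <= delta by rewrite !divr_ge0 ?mulr_ge0// ltW.
apply: (@lebesgue_radial_diameter_le _ _ (foot xi)) => // s s'.
move=> /E_le[sL Fs ms] /E_le[s'L Fs' _].
have [ss'|s's] := leP `|s - foot xi| `|s' - foot xi|; last first.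
  by apply: le_trans delta0; rewrite subr_le0 ltW.
have dF_eps : `|F (on_line xi s) - F (on_line xi s')| <= eps.
  by move: Fs Fs' => /andP[? ?] /andP[? ?]; rewrite ler_norml; apply/andP; split; lra.
rewrite /delta !ler_pdivlMr ?mulr_gt0//; apply: le_trans (ler_wpM2l L30 dF_eps).
apply: le_trans (line_weight_gap L0 sL s'L ss').
rewrite (_ : _ * k * _ = rho * k * m * (`|s' - foot xi| - `|s - foot xi|)); last first.
  by ring.
by rewrite ler_wpM2r ?subr_ge0// ler_wpM2l// mulr_ge0// ltW.
Qed.

End orthogonal_line.
End plane_geometry.

Section plane_measure.
Context {R : realType}.
Local Notation mR := (measurableTypeR R).
Local Notation leb := (@lebesgue_measure R).
Local Notation plane := (mR * mR)%type.
Implicit Types (a b z : plane) (A B : R) (S : set plane).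

Definition swap_coords z : plane := (z.2, z.1).

Lemma swap_coordsK : involutive swap_coords.
Proof. by case. Qed.

Lemma measurable_swap_coords : measurable_fun setT swap_coords.
Proof. exact: measurable_fun_pair. Qed.

Lemma max_dist_swap a b : max_dist (swap_coords a) (swap_coords b) = max_dist a b.
Proof. exact: maxC. Qed.

Lemma offset_sqdist_swap A a z :
  offset_sqdist A (swap_coords a) (swap_coords z) = offset_sqdist A a z.
Proof. by rewrite /offset_sqdist /=; ring. Qed.

Lemma offset_dist_diff_swap A B a b z :
  offset_dist_diff A B (swap_coords a) (swap_coords b) (swap_coords z) =
  offset_dist_diff A B a b z.
Proof. by rewrite /offset_dist_diff /offset_dist !offset_sqdist_swap. Qed.

Lemma offset_weight_swap A B a b z :
  offset_weight A B (swap_coords a) (swap_coords b) (swap_coords z) =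
  offset_weight A B a b z.
Proof.
rewrite /offset_weight /slope_weight !offset_sqdist_swap max_dist_swap.
by rewrite -[`|cross _ _ (swap_coords z)|]normrN opprB.
Qed.

(* As the coordinates may be exchanged, only slopes of modulus at most 1 matter. *)
Lemma plane_measure_le A B (c : R) (Q : plane -> plane -> set plane) :
  0 < c ->
  (forall a b z, Q a b z -> Q (swap_coords a) (swap_coords b) (swap_coords z)) ->
  (forall a b xi (E : set mR), a.1 != b.1 -> `|a.2 - b.2| <= `|a.1 - b.1| ->
    measurable E -> xi != equidistant_line A B a b ->
    (forall s, E s -> Q a b (line_point (slope a b) xi s)) ->
    (leb E <= c%:E * inv_sqrt (xi - equidistant_line A B a b))%E) ->
  forall a b S, 0 < max_dist a b -> measurable S -> S `<=` unit_square ->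
  S `<=` Q a b -> ((leb \x leb) S <= (7 * c)%:E)%E.
Proof.
move=> c0 Qswap lineQ a b S.
wlog ab : a b S / `|a.2 - b.2| <= `|a.1 - b.1| => [wl|] ab0 mS S01 SQ.
  have [ab|/ltW ba] := leP `|a.2 - b.2| `|a.1 - b.1|; first exact: (wl a b).
  rewrite product_measureC//; apply: (wl (swap_coords a) (swap_coords b)) => //.
  - by rewrite max_dist_swap.
  - exact: measurable_preimageT measurable_swap_coords mS.
  - by move=> z /S01[].
  - by move=> z /SQ/Qswap; rewrite [swap_coords (_, _)]swap_coordsK.
have ab1 : a.1 != b.1.
  rewrite -subr_eq0 -normr_gt0; move: ab0.
  by rewrite /max_dist; move/max_idPl : ab => ->.
apply: (product_lebesgue_shear_le (xi0 := equidistant_line A B a b) mS S01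
  (slope_le1 ab1 ab) c0) => xi xi_neq.
apply: lineQ => //; first exact: measurable_line_section.
by move=> s; exact: SQ.
Qed.

Lemma plane_sublevel_le A B a b (v : R) S : 0 < max_dist a b -> 0 < v ->
  measurable S -> S `<=` unit_square ->
  (forall z, S z -> offset_weight A B a b z <= v) ->
  ((leb \x leb) S <= (14 * v)%:E)%E.
Proof.
move=> ab0 v0 mS S01 Sv; rewrite (_ : 14 * v = 7 * (2 * v)); last by ring.
apply: (@plane_measure_le A B _ (fun a b z => offset_weight A B a b z <= v) _ _ _
  a b) => //; first by rewrite mulr_gt0.
- by move=> a' b' z; rewrite offset_weight_swap.
- by move=> a' b' xi E ab1 ab mE ? ?; exact: line_sublevel_le (ltW v0) _ _.
Qed.

Lemma plane_level_le A B a b (L y eps m : R) S : 0 < max_dist a b -> 0 < eps ->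
  0 < m -> 0 < L -> 0 <= A -> 0 <= B -> measurable S -> S `<=` unit_square ->
  (forall z, S z -> [/\ sqdists_le L A B a b z,
     y <= offset_dist_diff A B a b z <= y + eps & m <= offset_weight A B a b z]) ->
  ((leb \x leb) S <= (14 * (L ^+ 3 * eps / (max_dist a b * m)))%:E)%E.
Proof.
move=> ab0 eps0 m0 L0 A0 B0 mS S01 SQ; set t := L ^+ 3 * _ / _.
rewrite (_ : 14 * t = 7 * (2 * t)); last by ring.
pose Q a' b' z := [/\ max_dist a' b' = max_dist a b, sqdists_le L A B a' b' z,
  y <= offset_dist_diff A B a' b' z <= y + eps & m <= offset_weight A B a' b' z].
have t0 : 0 < 2 * t by rewrite !mulr_gt0 ?exprn_gt0// invr_gt0 mulr_gt0.
apply: (@plane_measure_le A B _ Q t0 _ _ a b) => //.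
- move=> a' b' z [? [? ?] ? ?].
  split; rewrite ?max_dist_swap ?offset_dist_diff_swap ?offset_weight_swap//.
  by rewrite /sqdists_le !offset_sqdist_swap.
- move=> a' b' xi E ab1 ab mE ? EQ.
  have [->|/set0P[s0 /EQ[abE _ _ _]]] := eqVneq E set0.
    by rewrite measure0 mule_ge0 ?inv_sqrt_ge0// lee_fin ltW.
  rewrite /t -abE.
  by apply: (line_level_le (y := y) ab1 ab A0 B0 mE eps0 m0 (ltW L0)) => // s /EQ[].
- by move=> z /SQ[].
Qed.

End plane_measure.

(** * From the plane to the cube *)

Section lebesgue_tuple_integrals.
Local Open Scope ereal_scope.
Context {R : realType}.
Local Notation mR := (measurableTypeR R).
Local Notation leb := (@lebesgue_measure R).

Lemma measurable_pcons1 d (x : mR) :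
  measurable_fun setT (fun p : Rpoint R d => pcons (x, p)).
Proof.
by apply: measurableT_comp; [exact: measurable_pcons|exact: pair1_measurable].
Qed.

Lemma integral_lebesgue_tupleS d (h : Rpoint R d.+1 -> \bar R) :
  measurable_fun setT h -> (forall p, 0 <= h p) ->
  \int[lebesgue_tuple d.+1]_p h p =
  \int[leb]_x \int[lebesgue_tuple d]_p h (pcons (x, p)).
Proof.
move=> mh h0.
rewrite [LHS](@ge0_integral_pushforward _ _ _ _ R _ (@measurable_pcons R d))//.
rewrite preimage_setT fubini_tonelli1//; last by move=> z; exact: h0.
by apply: measurableT_comp => //; exact: measurable_pcons.
Qed.

Lemma lebesgue_tupleSE d (A : set (Rpoint R d.+1)) :
  lebesgue_tuple d.+1 A = \int[leb]_x lebesgue_tuple d [set p | A (pcons (x, p))].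
Proof. by apply: eq_integral => x _ /=; rewrite xsectionE. Qed.

Lemma lebesgue_tuple1E (A : set (Rpoint R 1)) : measurable A ->
  lebesgue_tuple 1 A = leb [set x : mR | A [tuple x]].
Proof.
move=> mA; have mt : measurable_fun setT (fun x : mR => [tuple x] : Rpoint R 1).
  by apply/measurable_fun_tnthP => i; rewrite (_ : _ \o _ = id)//;
    apply/funext => x; rewrite /= ord1.
rewrite lebesgue_tupleSE -(integral_indicT leb (measurable_preimageT mt mA)).
by apply: eq_integral => x _; rewrite /= diracE indicE.
Qed.

Lemma lebesgue_tuple2E (A : set (Rpoint R 2)) : measurable A ->
  lebesgue_tuple 2 A = (leb \x leb) [set z | A [tuple z.1; z.2]].
Proof.
move=> mA; rewrite lebesgue_tupleSE; apply: eq_integral => x _ /=.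
rewrite lebesgue_tuple1E; last exact: measurable_preimageT (measurable_pcons1 x) mA.
rewrite xsectionE; congr (leb _); apply/seteqP; split => y; congr A; exact: val_inj.
Qed.

Lemma measurable_cat d k (t : Rpoint R d) :
  measurable_fun setT (fun p : Rpoint R k => [tuple of t ++ p] : Rpoint R (d + k)).
Proof.
apply/measurable_fun_tnthP => i.
rewrite (_ : _ \o _ = fun p : Rpoint R k => match fintype.split i with
   inl j => tnth t j | inr j => tnth p j end).
  by case: (fintype.split i) => j; [exact: measurable_cst|exact: measurable_tnth].
apply/funext => p /=; rewrite -{1}(splitK i).
by case: (fintype.split i) => j /=; rewrite ?tnth_lshift ?tnth_rshift.
Qed.

End lebesgue_tuple_integrals.

Section unit_cube_integrals.
Local Open Scope ereal_scope.
Context {R : realType}.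
Local Notation mR := (measurableTypeR R).
Local Notation leb := (@lebesgue_measure R).

Lemma measurable_unit_cube k : measurable (@unit_cube R k).
Proof.
rewrite (_ : unit_cube = \bigcap_(j in [set: 'I_k])
    ((fun p : Rpoint R k => tnth p j) @^-1` `[0%R, 1%R]%classic)).
  apply: fin_bigcap_measurable => // j _.
  by apply: measurable_preimageT => //; exact: measurable_tnth.
apply/seteqP; split => [p p01 j _|p p01 j].
  by rewrite /= in_itv; exact: p01.
by have := p01 j Logic.I; rewrite /= in_itv.
Qed.

Lemma unit_cube_pcons d (x : R) (p : Rpoint R d) :
  unit_cube (pcons (x, p)) <-> `[0%R, 1%R]%classic x /\ unit_cube p.
Proof.
split=> [xp01|[x01 p01] j].
  split; first by rewrite /= in_itv; exact: (xp01 ord0).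
  by move=> j; have := xp01 (lift ord0 j); rewrite tnthS.
case: (unliftP ord0 j) => [i ->|->]; first by rewrite tnthS; exact: p01.
by move: x01; rewrite /= in_itv.
Qed.

Lemma lebesgue_measure01 : leb `[0%R, 1%R]%classic = 1.
Proof. by rewrite lebesgue_measure_itvcc// subr0. Qed.

Lemma integral_unit_cubeS d (h : Rpoint R d.+1 -> \bar R) :
  measurable_fun setT h -> (forall p, 0 <= h p) ->
  \int[lebesgue_tuple d.+1]_(p in unit_cube) h p =
  \int[leb]_(x in `[0%R, 1%R]%classic)
    \int[lebesgue_tuple d]_(p in unit_cube) h (pcons (x, p)).
Proof.
move=> mh h0; rewrite integral_mkcond integral_lebesgue_tupleS; last 2 first.
- apply/(measurable_restrictT _ _).1; first exact: measurable_unit_cube.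
  exact: measurable_funTS.
- by move=> p; exact: erestrict_ge0.
rewrite [RHS]integral_mkcond; apply: eq_integral => x _; rewrite [RHS]patchE.
case: ifPn => [/set_mem x01|x01].
  rewrite [RHS]integral_mkcond; apply: eq_integral => p _; rewrite !patchE.
  by congr (if _ then _ else _); apply/idP/idP => /set_mem p01; apply/mem_set;
    [move/unit_cube_pcons: p01 => -[]|apply/unit_cube_pcons].
apply: integral0_eq => p _; rewrite patchE memNset// => /unit_cube_pcons[].
by move/mem_set; rewrite (negbTE x01).
Qed.

Lemma lebesgue_unit_cube d : lebesgue_tuple d (@unit_cube R d) = 1.
Proof.
elim: d => [|d IH]; first by rewrite /= diracE mem_set// => -[].
have intE k : \int[lebesgue_tuple k]_(p in @unit_cube R k) (cst 1 p) =
    lebesgue_tuple k unit_cube.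
  by rewrite integral_cst ?mul1e//; exact: measurable_unit_cube.
rewrite -intE integral_unit_cubeS//= -[RHS]lebesgue_measure01 -[RHS]mul1e.
rewrite -integral_cst//=; apply: eq_integral => x _.
by rewrite intE IH.
Qed.

Lemma integral_unit_cube1 (f : mR -> \bar R) :
  measurable_fun setT f -> (forall x, 0 <= f x) ->
  \int[lebesgue_tuple 1]_(p in unit_cube) f (tnth p ord0) =
  \int[leb]_(x in `[0%R, 1%R]%classic) f x.
Proof.
move=> mf f0; rewrite integral_unit_cubeS//; last first.
  by apply: (measurableT_comp mf); exact: measurable_tnth.
apply: eq_integral => x _; rewrite -[RHS]mule1 -(lebesgue_unit_cube 0).
by rewrite -integral_cst//; exact: measurable_unit_cube.
Qed.

Lemma integral_unit_cube2M (f g : mR -> \bar R) :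
  measurable_fun setT f -> measurable_fun setT g ->
  (forall x, 0 <= f x) -> (forall y, 0 <= g y) ->
  \int[lebesgue_tuple 2]_(p in unit_cube) (f (tnth p ord0) * g (tnth p ord_max)) =
  \int[leb]_(x in `[0%R, 1%R]%classic) f x * \int[leb]_(y in `[0%R, 1%R]%classic) g y.
Proof.
move=> mf mg f0 g0; rewrite integral_unit_cubeS//; last 2 first.
- apply: emeasurable_funM; first exact: (measurableT_comp mf (measurable_tnth _)).
  exact: (measurableT_comp mg (measurable_tnth _)).
- by move=> p; exact: mule_ge0.
rewrite -ge0_integralZr ?integral_ge0//; last exact: measurable_funTS.
apply: eq_integral => x _; rewrite -(integral_unit_cube1 mg g0) -ge0_integralZl//.
- by apply: eq_integral => p _; congr (_ * g _); rewrite !(tnth_nth 0%R).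
- exact: measurable_unit_cube.
- apply: measurable_funTS; apply: (measurableT_comp mg); exact: measurable_tnth.
Qed.

Lemma integral_unit_cube_cat_le d k (h : Rpoint R (d + k) -> \bar R) (K : \bar R) :
  measurable_fun setT h -> (forall p, 0 <= h p) -> 0 <= K ->
  (forall t : Rpoint R d,
     \int[lebesgue_tuple k]_(p in unit_cube) h [tuple of t ++ p] <= K) ->
  \int[lebesgue_tuple (d + k)]_(p in unit_cube) h p <= K.
Proof.
elim: d => [|d IH] in h * => mh h0 K0 hK.
  move: (hK [tuple]); congr (_ <= _); apply: eq_integral => p _; congr h.
  exact: val_inj.
rewrite (@integral_unit_cubeS (d + k) h)// -[leRHS]mule1 -lebesgue_measure01.
apply: ge0_integral_le_cst => // x _; rewrite integral_ge0//=.
apply: IH => //; first exact: (measurableT_comp mh (measurable_pcons1 x)).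
move=> t; move: (hK [tuple of x :: t]); congr (_ <= _); apply: eq_integral => p _.
congr h; exact: val_inj.
Qed.

Lemma lebesgue_unit_cube_cat_le d k (A : set (Rpoint R (d + k))) (K : \bar R) :
  measurable A -> A `<=` unit_cube -> 0 <= K ->
  (forall t : Rpoint R d,
     lebesgue_tuple k [set p : Rpoint R k | A [tuple of t ++ p]] <= K) ->
  lebesgue_tuple (d + k) A <= K.
Proof.
move=> mA Acube K0 AK; rewrite -[A in leLHS](setIidl Acube).
rewrite -integral_indic//; last exact: measurable_unit_cube.
apply: integral_unit_cube_cat_le => //; first exact/measurable_EFinP/measurable_indic.
move=> t; apply: le_trans (AK t).
have mAt : measurable [set p : Rpoint R k | A [tuple of t ++ p]].
  exact: measurable_preimageT (measurable_cat t) mA.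
have mcube := @measurable_unit_cube k.
by rewrite (integral_indic _ mcube mAt) le_measure ?inE//; exact: measurableI.
Qed.

End unit_cube_integrals.

Section measurable_points.
Context {disp : measure_display} {T : measurableType disp} {R : realType}.
Local Notation mR := (measurableTypeR R).

Lemma measurable_bool_set (b : T -> bool) : measurable_fun setT b ->
  measurable [set x | b x].
Proof.
move=> mb; have := mb measurableT [set true] Logic.I; rewrite setTI.
by congr measurable; apply/seteqP; split.
Qed.

Lemma measurable_fun_sqrt (f : T -> mR) : measurable_fun setT f ->
  measurable_fun setT (fun x => Num.sqrt (f x) : mR).
Proof.
move=> mf; apply: (measurableT_comp (f := @Num.sqrt R : mR -> mR)) => //.
by apply: continuous_measurable_fun; exact: sqrt_continuous.
Qed.

Lemma measurable_fun_normr (f : T -> mR) : measurable_fun setT f ->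
  measurable_fun setT (fun x => `|f x| : mR).
Proof. exact: (measurableT_comp (@normr_measurable R setT)). Qed.

Lemma measurable_fun_tnth d (f : T -> Rpoint R d) j : measurable_fun setT f ->
  measurable_fun setT (fun x => tnth (f x) j : mR).
Proof. exact: (measurableT_comp (@measurable_tnth _ mR d j)). Qed.

End measurable_points.

Section sqdist.
Context {R : realType}.
Local Notation mR := (measurableTypeR R).

Definition sqdist d (p q : Rpoint R d) : R :=
  \sum_(j < d) ((tnth p j : R) - tnth q j) ^+ 2.

Lemma sqdist_ge0 d (p q : Rpoint R d) : 0 <= sqdist p q.
Proof. by apply: sumr_ge0 => j _; exact: sqr_ge0. Qed.

Lemma sqdist_cube_le d (p q : Rpoint R d) : unit_cube p -> unit_cube q ->
  sqdist p q <= d%:R.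
Proof.
move=> p01 q01; rewrite [leRHS](_ : _ = \sum_(j < d) 1); last first.
  by rewrite sumr_const card_ord.
apply: ler_sum => j _.
by have /andP[? ?] := p01 j; have /andP[? ?] := q01 j; nra.
Qed.

Lemma dist2_cube_le d (p q : Rpoint R d) : unit_cube p -> unit_cube q ->
  dist2 p q <= Num.sqrt d%:R.
Proof. by move=> p01 q01; apply: ler_wsqrtr; exact: sqdist_cube_le. Qed.

Lemma measurable_fun_sqdist {disp : measure_display} {T : measurableType disp} d
    (f g : T -> Rpoint R d) : measurable_fun setT f -> measurable_fun setT g ->
  measurable_fun setT (fun x => sqdist (f x) (g x) : mR).
Proof.
move=> mf mg; apply: measurable_sum => j; apply: measurable_funX.
by apply: measurable_funB; exact: measurable_fun_tnth.
Qed.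

Lemma measurable_fun_dist2 {disp : measure_display} {T : measurableType disp} d
    (f g : T -> Rpoint R d) : measurable_fun setT f -> measurable_fun setT g ->
  measurable_fun setT (fun x => dist2 (f x) (g x) : mR).
Proof. by move=> mf mg; exact/measurable_fun_sqrt/measurable_fun_sqdist. Qed.

End sqdist.

Section tuple_geometry.
Context {R : realType} {d : nat}.
Local Notation mR := (measurableTypeR R).
Local Notation leb := (@lebesgue_measure R).
Local Notation plane := (mR * mR)%type.
Local Notation point := (Rpoint R (d + 2)).
Local Notation lambda := (lebesgue_tuple (d + 2)).
Implicit Types (a b x : point) (t : Rpoint R d) (z : plane).

(* The last two coordinates span the plane because [lebesgue_tuple] integrates
   the leading coordinates outermost. *)
Definition plane_proj x : plane := (tnth x (rshift d ord0), tnth x (rshift d ord_max)).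

Definition prefix a : Rpoint R d := [tuple tnth a (lshift 2 j) | j < d].

Definition append_plane t z : point := [tuple of t ++ [tuple z.1; z.2]].

Definition dist_diff a b x : R := dist2 x a - dist2 x b.

Definition plane_gap a b : R := max_dist (plane_proj a) (plane_proj b).

Definition weight a b x : R :=
  slope_weight (sqdist x a - sqdist x b) (plane_proj a) (plane_proj b) (plane_proj x).

Lemma plane_proj_append t z : plane_proj (append_plane t z) = z.
Proof. by case: z => u v; rewrite /plane_proj !tnth_rshift. Qed.

Lemma sqdist_append t z a : sqdist (append_plane t z) a =
  offset_sqdist (sqdist t (prefix a)) (plane_proj a) z.
Proof.
rewrite /sqdist big_split_ord/= /offset_sqdist -addrA; congr (_ + _).
  by apply: eq_bigr => j _; rewrite tnth_lshift tnth_mktuple.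
rewrite !big_ord_recl big_ord0 addr0 !tnth_rshift/=.
by congr (_ + _ ^+ 2); congr (_ - tnth _ (rshift _ _)); exact: val_inj.
Qed.

Lemma dist_diff_append t z a b : dist_diff a b (append_plane t z) =
  offset_dist_diff (sqdist t (prefix a)) (sqdist t (prefix b))
    (plane_proj a) (plane_proj b) z.
Proof. by rewrite /offset_dist_diff /offset_dist -!sqdist_append. Qed.

Lemma weight_append t z a b : weight a b (append_plane t z) =
  offset_weight (sqdist t (prefix a)) (sqdist t (prefix b))
    (plane_proj a) (plane_proj b) z.
Proof. by rewrite /weight plane_proj_append !sqdist_append. Qed.

Lemma unit_square_append t z : unit_cube (append_plane t z) -> unit_square z.
Proof.
by move=> tz01; split; rewrite /= in_itv;
  [have := tz01 (rshift d ord0)|have := tz01 (rshift d ord_max)]; rewrite tnth_rshift.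
Qed.

Lemma measurable_append_plane t : measurable_fun setT (append_plane t).
Proof.
apply: (measurableT_comp (measurable_cat t)).
apply/measurable_fun_tnthP => j.
have [->|j0] := eqVneq j ord0; first exact: measurable_fst.
rewrite (_ : _ \o _ = snd); first exact: measurable_snd.
by apply/funext => z; case: j j0 => -[|[|]].
Qed.

Lemma lebesgue_tuple_append_le (A : set point) (K : \bar R) : measurable A ->
  A `<=` unit_cube -> (0 <= K)%E ->
  (forall t, (leb \x leb) [set z | A (append_plane t z)] <= K)%E ->
  (lambda A <= K)%E.
Proof.
move=> mA Acube K0 AK; apply: lebesgue_unit_cube_cat_le => // t.
rewrite lebesgue_tuple2E; first exact: AK.
exact: measurable_preimageT (measurable_cat t) mA.
Qed.

Lemma weight_sublevel_le a b (v : R) (A : set point) : 0 < plane_gap a b ->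
  0 < v -> measurable A -> A `<=` unit_cube ->
  (forall x, A x -> weight a b x <= v) ->
  (lambda A <= (14 * v)%:E)%E.
Proof.
move=> ab0 v0 mA Acube Av; apply: lebesgue_tuple_append_le => //.
  by rewrite lee_fin mulr_ge0// ltW.
move=> t; apply: (plane_sublevel_le (A := sqdist t (prefix a))
  (B := sqdist t (prefix b)) ab0 v0).
- exact: measurable_preimageT (measurable_append_plane t) mA.
- by move=> z /Acube/unit_square_append.
- by move=> z /Av; rewrite weight_append.
Qed.

Lemma weight_level_le a b (y eps m : R) (A : set point) : 0 < plane_gap a b ->
  0 < eps -> 0 < m -> unit_cube a -> unit_cube b -> measurable A ->
  A `<=` unit_cube ->
  (forall x, A x -> y <= dist_diff a b x <= y + eps /\ m <= weight a b x) ->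
  (lambda A <=
    (14 * (Num.sqrt (d + 2)%:R ^+ 3 * eps / (plane_gap a b * m)))%:E)%E.
Proof.
move=> ab0 eps0 m0 a01 b01 mA Acube Ayw; set L := Num.sqrt _.
have L0 : 0 < L by rewrite sqrtr_gt0 ltr0n addn2.
apply: lebesgue_tuple_append_le => //.
  by rewrite lee_fin mulr_ge0// divr_ge0 ?mulr_ge0 ?exprn_ge0// ltW.
move=> t; apply: (plane_level_le (A := sqdist t (prefix a))
  (B := sqdist t (prefix b)) (y := y) ab0 eps0 m0 L0); rewrite ?sqdist_ge0//.
- exact: measurable_preimageT (measurable_append_plane t) mA.
- by move=> z /Acube/unit_square_append.
- move=> z Az; have [Az1 Az2] := Ayw _ Az.
  rewrite -dist_diff_append -weight_append; split=> //.
  by rewrite /sqdists_le -!sqdist_append sqr_sqrtr// !sqdist_cube_le//; exact: Acube.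
Qed.

Lemma measurable_weight a b : measurable_fun setT (weight a b : point -> mR).
Proof.
apply: measurable_funM; last first.
  apply: measurable_funM => //; apply: measurable_fun_normr.
  by apply: measurable_funB; apply: measurable_funM => //;
    apply: measurable_funB => //; exact: measurable_tnth.
apply: measurable_fun_sqrt; apply: measurable_funM => //.
apply: measurable_fun_normr.
by apply: measurable_funB; exact: measurable_fun_sqdist.
Qed.

End tuple_geometry.

(** * Differences of independent samples *)

Section harmonic_sums.
Context {R : realType}.

Lemma series_harmonic_ge0 J : 0 <= series (@harmonic R) J.
Proof. by apply: sumr_ge0 => j _; exact: harmonic_ge0. Qed.

Lemma subr1V_le_ln (x : R) : 0 < x -> 1 - x^-1 <= ln x.
Proof.
move=> x0; rewrite -[x in leRHS]invrK lnV ?posrE ?invr_gt0// lerNr.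
rewrite [leLHS](_ : _ = ln (1 + (x^-1 - 1))); last by rewrite addrC subrK.
apply: (le_trans (le_ln1Dx _)); first by rewrite ltrBrDr addNr invr_gt0.
by rewrite opprB.
Qed.

Lemma series_harmonic_le J : (0 < J)%N -> series (@harmonic R) J <= 1 + ln J%:R.
Proof.
case: J => // J _; elim: J => [|J IH].
  by rewrite /series /= big_nat1 invr1 ln1 addr0.
rewrite seriesS addrC; apply: (le_trans (lerD IH (lexx _))).
rewrite -addrA lerD2l -lerBrDl -ln_div ?posrE//.
apply: le_trans (subr1V_le_ln _); last by rewrite divr_gt0.
rewrite invf_div -[X in X - _](@divff _ J.+2%:R) ?pnatr_eq0//.
by rewrite -mulrBl -natrB// subSnn mul1r.
Qed.

(* min(1, K / w) is at most K plus K times the number of j <= J with w <= 1 / j,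
   so that its integral becomes a harmonic sum. *)
Lemma min_inverse_le_count (w K : R) (J : nat) (tau : \bar R) : 0 <= K ->
  1 <= K * J%:R -> (tau <= 1)%E -> (0 < w -> (tau <= (K / w)%:E)%E) ->
  (tau <= (K + \sum_(0 <= j < J) K * (w <= harmonic j)%R%:R)%:E)%E.
Proof.
move=> K0 KJ tau1 tauw.
have all_le i : (forall j, (j < i)%N -> w <= harmonic j) ->
    \sum_(0 <= j < i) K * (w <= harmonic j)%R%:R = K * i%:R.
  move=> w_le; rewrite big_nat (eq_bigr (fun=> K)) => [|j /andP[_ ji]].
    by rewrite -big_nat sumr_const_nat subn0 mulr_natr.
  by rewrite w_le// mulr1.
have [/existsP[i0 lt_w]|/existsPn w_le] := boolP [exists j : 'I_J, harmonic j < w];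
  last first.
  apply: (le_trans tau1); rewrite lee_fin all_le ?ler_wpDl// => j jJ.
  by rewrite leNgt; exact: (w_le (Ordinal jJ)).
have ex_lt : exists j, (j < J)%N && (harmonic j < w) by exists i0; rewrite ltn_ord.
case: (ex_minnP ex_lt) => j0 /andP[j0J j0w] minj0.
have w0 : 0 < w by exact: lt_trans (harmonic_gt0 j0) j0w.
apply: (le_trans (tauw w0)); rewrite lee_fin.
apply: (@le_trans _ _ (K * j0.+1%:R)).
  by rewrite ler_wpM2l// -[leRHS]invrK lef_pV2 ?posrE ?invr_gt0// ltW.
rewrite -natr1 mulrDr mulr1 addrC lerD2l (big_cat_nat _ (n := j0)) ?(ltnW j0J)//=.
rewrite all_le => [|j jj0].
  by rewrite lerDl; apply: sumr_ge0 => j _; rewrite mulr_ge0.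
rewrite leNgt; apply/negP => lt_wj; have := minj0 j.
by rewrite lt_wj (ltn_trans jj0 j0J) leqNgt jj0 => /(_ isT).
Qed.

End harmonic_sums.

Section small_differences.
Context {disp : measure_display} {T : measurableType disp} {R : realType}.
Variables (mu : {sigma_finite_measure set T -> \bar R}) (D : set T).
Variables (W : T -> measurableTypeR R) (c K : R) (J : nat).
Hypotheses (mD : measurable D) (D1 : (mu D <= 1)%E) (mW : measurable_fun setT W).
Hypotheses (K0 : 0 <= K) (KJ : 1 <= K * J%:R).
Hypothesis sublevel_le : forall v, 0 < v ->
  (mu (D `&` [set x | ((W x : R) <= v)%R]) <= (c * v)%:E)%E.

Let bound : R := K * (1 + c * series harmonic J).

Lemma integral_min_inverse_le (h : T -> \bar R) :
  (forall x, D x -> 0 <= h x <= 1)%E ->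
  (forall x, D x -> 0 < (W x : R) -> (h x <= (K / W x)%:E)%E) ->
  (\int[mu]_(x in D) h x <= bound%:E)%E.
Proof.
move=> h01 hW.
pose Wle (j : nat) := [set x | ((W x : R) <= harmonic j)%R].
have mWle j : measurable (Wle j).
  by apply: measurable_bool_set; apply: measurable_fun_ler => //; exact: measurable_cst.
have mKind j : measurable_fun D (fun x => (K%:E * (\1_(Wle j) x)%:E)%E).
  by apply: measurable_funTS; apply: measurable_funeM;
    exact/measurable_EFinP/measurable_indic.
have Kind0 j x : (0 <= K%:E * (\1_(Wle j) x)%:E)%E by rewrite mule_ge0 ?lee_fin.
apply: (@le_trans _ _ (\int[mu]_(x in D) (K%:E +
    \sum_(0 <= j < J) (K%:E * (\1_(Wle j) x)%:E)))%E).
  apply: ge0_le_nonmeasurable_integral => x Dx; first by have /andP[] := h01 x Dx.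
  have /andP[_ h1] := h01 x Dx.
  apply: (le_trans (min_inverse_le_count K0 KJ h1 (hW x Dx))).
  rewrite EFinD -sumEFin leeD2l//; apply: lee_sum => j _.
  rewrite indicE -EFinM lee_fin.
  by rewrite (_ : (x \in Wle j) = (W x <= harmonic j)%R)// mem_setE.
rewrite ge0_integralD//; last 2 first.
- by move=> x _; rewrite sume_ge0.
- exact: emeasurable_sum.
rewrite ge0_integral_sum// /bound mulrDr mulr1 EFinD; apply: leeD.
  by rewrite integral_cst// -[leRHS]mule1 lee_wpmul2l ?lee_fin.
rewrite /series/= !mulr_sumr -sumEFin; apply: lee_sum => j _.
rewrite ge0_integralZl//; last first.
  by apply: measurable_funTS; exact/measurable_EFinP/measurable_indic.
rewrite integral_indic// setIC EFinM lee_wpmul2l ?lee_fin//.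
by apply: sublevel_le; exact: harmonic_gt0.
Qed.

Variables (F : T -> measurableTypeR R) (eps : R).
Hypothesis level_le : forall (y w : R) (A : set T), 0 < w -> measurable A ->
  A `<=` D -> (forall x, A x -> (y <= F x <= y + eps)%R /\ (w <= W x)%R) ->
  (mu A <= (K / w)%:E)%E.

Lemma integral_level_sections_le (A : T -> set T) :
  (forall x, measurable (A x)) -> (forall x, A x `<=` D) ->
  (forall x, ~ D x -> A x = set0) ->
  (forall x, exists y, forall x', A x x' ->
    (y <= F x' <= y + eps)%R /\ (W x <= W x')%R) ->
  (\int[mu]_x mu (A x) <= bound%:E)%E.
Proof.
move=> mA AD A0 Alevel; rewrite -(@integral_support _ _ _ mu D) => [|x /A0->//].
apply: integral_min_inverse_le => x _.
  by rewrite measure_ge0/= (le_trans _ D1)// le_measure ?inE.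
by move=> W0; have [y Ay] := Alevel x; exact: (level_le (y := y)).
Qed.

(* Split according to which of the two points has the smaller weight, and
   integrate over that point first. *)
Lemma small_differences_le (E : set (T * T)) : measurable E ->
  (forall z, E z -> [/\ D z.1, D z.2 & (0 <= F z.1 - F z.2 <= eps)%R]) ->
  ((mu \x mu) E <= (2 * bound)%:E)%E.
Proof.
move=> mE ED.
pose E1 := E `&` [set z | (W z.1 <= W z.2)%R].
pose E2 := E `&` [set z | (W z.2 <= W z.1)%R].
have mW1 : measurable_fun setT (fun z : T * T => W z.1) by exact: measurableT_comp.
have mW2 : measurable_fun setT (fun z : T * T => W z.2) by exact: measurableT_comp.
have mE1 : measurable E1.
  by apply: measurableI => //; apply: measurable_bool_set; exact: measurable_fun_ler.
have mE2 : measurable E2.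
  by apply: measurableI => //; apply: measurable_bool_set; exact: measurable_fun_ler.
rewrite (_ : E = E1 `|` E2); last first.
  by rewrite -setIUr; apply/esym/setIidPl => z _; exact/orP/le_total.
apply: (le_trans (measureU2 _ mE1 mE2)).
rewrite mulr_natl mulr2n EFinD.
apply: leeD; last rewrite [leLHS](product_measure12E _ _ mE2).
- apply: integral_level_sections_le => x; first exact: measurable_xsection.
  + by move=> x' /xsectionP[/ED[]].
  + by move=> nDx; apply/seteqP; split => // x' /xsectionP[/ED[]].
  exists (F x - eps) => x' /xsectionP[/ED[_ _ /andP[/= ? ?]] ?].
  by split => //; apply/andP; split; lra.
- apply: integral_level_sections_le => x; first exact: measurable_ysection.
  + by move=> x' /ysectionP[/ED[]].
  + by move=> nDx; apply/seteqP; split => // x' /ysectionP[/ED[]].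
  exists (F x) => x' /ysectionP[/ED[_ _ /andP[/= ? ?]] ?].
  by split => //; apply/andP; split; lra.
Qed.

End small_differences.

(** * The gain of a random 2-change *)

Section inverse_gap.
Local Open Scope ereal_scope.
Context {R : realType} {d : nat}.
Local Notation mR := (measurableTypeR R).
Local Notation leb := (@lebesgue_measure R).
Local Notation point := (Rpoint R (d + 2)).
Implicit Types a b : point.

Definition inv_gap_bound b a : \bar R :=
  inv_sqrt ((plane_proj a).1 - (plane_proj b).1)%R *
  inv_sqrt ((plane_proj a).2 - (plane_proj b).2)%R.

Lemma inv_gap_bound_ge0 b a : 0 <= inv_gap_bound b a.
Proof. by rewrite mule_ge0 ?inv_sqrt_ge0. Qed.

Lemma measurable_inv_gap_bound b : measurable_fun setT (inv_gap_bound b).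
Proof.
by apply: emeasurable_funM; apply: (measurableT_comp (measurable_inv_sqrt_shift _));
  exact: measurable_tnth.
Qed.

(* The maximum of two numbers is at least their geometric mean. *)
Lemma inv_plane_gap_le b a : (plane_gap a b)%:E^-1 <= inv_gap_bound b a.
Proof.
rewrite /inv_gap_bound /plane_gap /max_dist.
set u := (_ - _)%R; set v := ((plane_proj a).2 - _)%R.
have [->|u0] := eqVneq u 0%R; first by rewrite inv_sqrt0 gt0_mulye ?leey// inv_sqrt_gt0.
have [->|v0] := eqVneq v 0%R; first by rewrite inv_sqrt0 gt0_muley ?leey// inv_sqrt_gt0.
have m0 : (0 < Num.max `|u| `|v|)%R by rewrite lt_max normr_gt0 u0.
rewrite !inv_sqrtE// inver gt_eqF// -EFinM lee_fin -invfM.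
rewrite lef_pV2 ?posrE ?mulr_gt0 ?sqrtr_gt0 ?normr_gt0// -sqrtrM//.
rewrite -[leRHS](gtr0_norm m0) -[leRHS]sqrtr_sqr ler_wsqrtr// expr2.
by apply: ler_pM => //; rewrite le_max lexx ?orbT.
Qed.

Lemma integral_inv_gap_bound b :
  \int[lebesgue_tuple (d + 2)]_(a in unit_cube) inv_gap_bound b a <= 25%:E.
Proof.
apply: integral_unit_cube_cat_le => //.
- exact: measurable_inv_gap_bound.
- exact: inv_gap_bound_ge0.
have int5 (x0 : R) : \int[leb]_(x in `[0%R, 1%R]%classic) inv_sqrt (x - x0)%R <= 5%:E.
  apply: (le_trans (integral_inv_sqrt_shift_le _ _)) => //.
  by rewrite lee_fin; lra.
move=> t; rewrite /inv_gap_bound /plane_proj.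
under eq_integral do rewrite /= !tnth_rshift.
pose f (x0 x : mR) := inv_sqrt (x - x0)%R.
rewrite (@integral_unit_cube2M _ (f _) (f _)) /f.
- rewrite (_ : 25 = 5 * 5)%R; last by rewrite -natrM.
  by rewrite EFinM lee_pmul ?int5// integral_ge0// => x _; exact: inv_sqrt_ge0.
- exact: measurable_inv_sqrt_shift.
- exact: measurable_inv_sqrt_shift.
- by move=> x; exact: inv_sqrt_ge0.
- by move=> x; exact: inv_sqrt_ge0.
Qed.

End inverse_gap.

Section two_change_gain.
Context {R : realType}.

Lemma dist2C d (p q : Rpoint R d) : dist2 p q = dist2 q p.
Proof. by congr Num.sqrt; apply: eq_bigr => j _; rewrite -sqrrN opprB. Qed.

(* The vertices are in the order along the tour. *)
Definition two_change_gain d (u1 u2 v1 v2 : Rpoint R d) : R :=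
  dist2 u1 u2 + dist2 v1 v2 - (dist2 u1 v1 + dist2 u2 v2).

Lemma two_change_gainE d (u1 u2 v1 v2 : Rpoint R (d + 2)) :
  two_change_gain u1 u2 v1 v2 = dist_diff u2 v1 u1 - dist_diff u2 v1 v2.
Proof.
by rewrite /two_change_gain /dist_diff (dist2C v1) (dist2C u2 v2); ring.
Qed.

Lemma measurable_fun_two_change_gain {disp : measure_display}
    {T : measurableType disp} d (u1 u2 v1 v2 : T -> Rpoint R d) :
  measurable_fun setT u1 -> measurable_fun setT u2 ->
  measurable_fun setT v1 -> measurable_fun setT v2 ->
  measurable_fun setT (fun w =>
    two_change_gain (u1 w) (u2 w) (v1 w) (v2 w) : measurableTypeR R).
Proof.
by move=> *; apply: measurable_funB; apply: measurable_funD;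
  exact: measurable_fun_dist2.
Qed.

End two_change_gain.

Section small_gain.
Context {R : realType} {d : nat}.
Local Notation mR := (measurableTypeR R).
Local Notation point := (Rpoint R (d + 2)).
Local Notation lambda := (@lebesgue_tuple R (d + 2)).
Local Notation L := (Num.sqrt (d + 2)%:R : R).
Implicit Types a b : point.

Lemma plane_gap_le1 a b : unit_cube a -> unit_cube b -> plane_gap a b <= 1.
Proof.
move=> a01 b01; have coord_le j : `|(tnth a j : R) - tnth b j| <= 1.
  have /andP[? ?] := a01 j; have /andP[? ?] := b01 j.
  by rewrite ler_norml; apply/andP; split; lra.
by rewrite /plane_gap /max_dist ge_max !coord_le.
Qed.

Lemma sqrt_dim_ge1 : 1 <= L.
Proof. by rewrite -[leLHS]sqrtr1 ler_wsqrtr// ler1n addn2. Qed.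

Variables (eps : R) (J : nat).
Hypotheses (eps0 : 0 < eps) (Jeps : 1 <= eps * J%:R).

Definition pair_constant : R := 28 * L ^+ 3 * (eps * (1 + 14 * series harmonic J)).

Lemma pair_constant_gt0 : 0 < pair_constant.
Proof.
have H0 := @series_harmonic_ge0 R J.
have L0 : 0 < L by exact: lt_le_trans sqrt_dim_ge1.
by rewrite !mulr_gt0 ?exprn_gt0// ltr_wpDr// mulr_ge0.
Qed.

Lemma close_dist_diff_le a b (E : set (point * point)) :
  unit_cube a -> unit_cube b -> measurable E ->
  (forall z, E z -> [/\ unit_cube z.1, unit_cube z.2 &
    0 <= dist_diff a b z.1 - dist_diff a b z.2 <= eps]) ->
  ((lambda \x lambda) E <= pair_constant%:E * (plane_gap a b)%:E^-1)%E.
Proof.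
move=> a01 b01 mE E01.
have [gap0|] := ltP 0 (plane_gap a b); last first.
  rewrite le_eqVlt ltNge le_max normr_ge0 orbF => /eqP->.
  by rewrite inve0 gt0_muley ?leey// lte_fin pair_constant_gt0.
pose K := 14 * (L ^+ 3 * eps / plane_gap a b).
have eps_le_K : eps <= K.
  rewrite /K (_ : 14 * _ = (14 * L ^+ 3) * (eps / plane_gap a b)); last by ring.
  rewrite -[leLHS]mul1r ler_pM ?(ltW eps0)//.
    by have := exprn_ege1 3 sqrt_dim_ge1; lra.
  by rewrite ler_pdivlMr// ler_piMr ?(ltW eps0)// plane_gap_le1.
rewrite inver gt_eqF// -EFinM.
rewrite (_ : _ / _ = 2 * (K * (1 + 14 * series harmonic J))); last first.
  by rewrite /pair_constant /K; ring.
apply: (@small_differences_le _ _ _ lambda unit_cube (weight a b) 14 K J _ _ _ _ _ _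
  (dist_diff a b) eps) => //.
- exact: measurable_unit_cube.
- by rewrite lebesgue_unit_cube.
- exact: measurable_weight.
- exact: le_trans (ltW eps0) eps_le_K.
- by apply: (le_trans Jeps); rewrite ler_wpM2r.
- move=> v v0; apply: (weight_sublevel_le gap0 v0) => [||x []//].
  + apply: measurableI; first exact: measurable_unit_cube.
    apply: measurable_bool_set; apply: measurable_fun_ler => //.
    exact: measurable_weight.
  + by move=> x [].
- move=> y w A w0 mA A01 Ayw.
  rewrite /K -mulrA -[_ / plane_gap a b / w]mulrA -invfM.
  exact: (weight_level_le (y := y) gap0 eps0 w0 a01 b01 mA A01).
Qed.

Definition small_gain : set (point * (point * (point * point))) :=
  [set z | let: (v1, (u2, (u1, v2))) := z in
    [/\ unit_cube v1, unit_cube u2, unit_cube u1, unit_cube v2 &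
    0 < two_change_gain u1 u2 v1 v2 <= eps]].

Lemma measurable_small_gain : measurable small_gain.
Proof.
pose T4 := (point * (point * (point * point)))%type.
have mv1 : measurable_fun setT (fun z : T4 => z.1) by exact: measurable_fst.
have mu2 : measurable_fun setT (fun z : T4 => z.2.1).
  exact: (measurableT_comp measurable_fst measurable_snd).
have m22 : measurable_fun setT (fun z : T4 => z.2.2).
  exact: (measurableT_comp measurable_snd measurable_snd).
have mu1 : measurable_fun setT (fun z : T4 => z.2.2.1).
  exact: (measurableT_comp measurable_fst m22).
have mv2 : measurable_fun setT (fun z : T4 => z.2.2.2).
  exact: (measurableT_comp measurable_snd m22).
pose gain (z : T4) := two_change_gain z.2.2.1 z.2.1 z.1 z.2.2.2.
have mgain : measurable_fun setT (gain : T4 -> mR).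
  exact: measurable_fun_two_change_gain.
rewrite (_ : small_gain =
  [set z | unit_cube z.1] `&` [set z | unit_cube z.2.1] `&`
  [set z | unit_cube z.2.2.1] `&` [set z | unit_cube z.2.2.2] `&`
  [set z | 0 < gain z <= eps]).
  apply: measurableI.
    have mcube := @measurable_unit_cube R (d + 2).
    by do ?[apply: measurableI]; apply: measurable_preimageT mcube.
  apply: measurable_bool_set; apply: measurable_and.
    by apply: measurable_fun_ltr => //; exact: measurable_cst.
  by apply: measurable_fun_ler => //; exact: measurable_cst.
apply/seteqP; split => -[v1 [u2 [u1 v2]]]; first by case.
by move=> [[[[? ?] ?] ?] ?].
Qed.

Lemma small_gain_section_le (phi psi : R) (m : {measure set point -> \bar R})
    (mm : {measure set (point * point) -> \bar R}) b : 0 <= phi -> 0 <= psi ->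
  density_le phi m lambda -> density_le psi mm (lambda \x lambda)%E ->
  (\int[m]_a mm (xsection (xsection small_gain b) a) <=
    (phi * psi * (25 * pair_constant))%:E)%E.
Proof.
move=> phi0 psi0 m_le mm_le; pose g := inv_gap_bound b \_ unit_cube.
have C0 := pair_constant_gt0; have psiC0 : 0 <= psi * pair_constant.
  by rewrite mulr_ge0// ltW.
have g0 a : (0 <= g a)%E by apply: erestrict_ge0 => *; exact: inv_gap_bound_ge0.
have mg : measurable_fun setT g.
  apply/(measurable_restrictT _ _).1; first exact: measurable_unit_cube.
  exact: (measurable_funTS (measurable_inv_gap_bound b)).
apply: (@le_trans _ _ (\int[m]_a ((psi * pair_constant)%:E * g a))%E).
  apply: ge0_le_nonmeasurable_integral => // a _.
  have mS := measurable_xsection a (measurable_xsection b measurable_small_gain).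
  have [[a01 b01]|nab01] := pselect (unit_cube a /\ unit_cube b); last first.
    rewrite (_ : xsection _ _ = set0) ?measure0 ?mule_ge0//.
    apply/seteqP; split => // -[u1 v2] /xsectionP/xsectionP[b01 a01 _ _ _].
    exact: nab01 (conj a01 b01).
  rewrite /g patchE mem_set// EFinM -muleA; apply: (le_trans (mm_le _ mS)).
  rewrite lee_wpmul2l ?lee_fin//; apply: (le_trans (close_dist_diff_le a01 b01 mS _)).
    move=> [u1 v2] /xsectionP/xsectionP[_ _ ? ?].
    by rewrite two_change_gainE => /andP[/ltW ? ?]; split => //; apply/andP; split.
  by rewrite lee_wpmul2l ?lee_fin ?(ltW C0)// inv_plane_gap_le.
rewrite ge0_integralZl//.
rewrite (_ : phi * _ * _ = psi * pair_constant * (phi * 25)); last by ring.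
rewrite [leRHS]EFinM lee_wpmul2l ?lee_fin//.
apply: (le_trans (density_le_integral phi0 m_le mg g0)).
by rewrite [leRHS]EFinM lee_wpmul2l ?lee_fin// -integral_mkcond integral_inv_gap_bound.
Qed.

End small_gain.

(** * Four independent points *)

Section independent_law.
Local Open Scope ereal_scope.
Context {disp : measure_display} {Omega : measurableType disp} {R : realType}
  (P : probability Omega R).

Definition independent_law {d : measure_display} {T : measurableType d}
    (G : set Omega) (Z : Omega -> T) (m : set T -> \bar R) :=
  forall B, measurable B -> P (G `&` Z @^-1` B) = P G * m B.

Lemma independent_law_pair {d1 d2 : measure_display} {T1 : measurableType d1}
    {T2 : measurableType d2} (m1 : {sigma_finite_measure set T1 -> \bar R})
    (m2 : {sigma_finite_measure set T2 -> \bar R}) (G : set Omega)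
    (X : Omega -> T1) (Z : Omega -> T2) :
  measurable G -> measurable_fun setT X -> measurable_fun setT Z ->
  independent_law G X m1 ->
  (forall A, measurable A -> independent_law (G `&` X @^-1` A) Z m2) ->
  independent_law G (fun w => (X w, Z w)) (m1 \x m2).
Proof.
move=> mG mX mZ GX GXZ E mE; set XZ := fun w => (X w, Z w).
have mXZ : measurable_fun setT XZ by exact: measurable_fun_pair.
have [PG0|PG0] := eqVneq (P G) 0.
  rewrite PG0 mul0e; apply/eqP; rewrite eq_le measure_ge0 andbT -PG0.
  apply: le_measure; rewrite ?inE//; apply: measurableI => //.
  exact: measurable_preimageT mXZ mE.
have PGfin : P G \is a fin_num by exact: fin_num_measure.
have g0 : (0 < fine (P G))%R by rewrite fine_gt0// lt0e PG0 measure_ge0 -ge0_fin_numE.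
have g0' : (0 <= (fine (P G))^-1)%R by rewrite invr_ge0 ltW.
have gK x : P G * ((fine (P G))^-1%:E * x) = x.
  by rewrite muleA -{1}(fineK PGfin) -EFinM mulfV ?mul1e// gt_eqF.
pose nu := measure_function_pushforward__canonical__measure_function_Measure
  (mrestr P mG) mXZ.
have nuE D : nu D = P (G `&` XZ @^-1` D) by rewrite /nu/= /pushforward /mrestr setIC.
rewrite (product_measure_unique (m' := mscale (NngNum g0') nu))//.
  by rewrite /= /mscale /= [nu _]nuE gK.
move=> B C mB mC; rewrite /= /mscale/= [nu _]nuE.
have -> : G `&` XZ @^-1` (B `*` C) = (G `&` X @^-1` B) `&` Z @^-1` C by exact: setIA.
by rewrite GXZ// GX// -muleA [LHS]muleCA gK.
Qed.

End independent_law.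

Section cylinders.
Context {R : realType} {n d : nat} {disp : measure_display}
  {Omega : measurableType disp} (P : probability Omega R).
Local Notation point := (Rpoint R d).
Variable X : 'I_n -> {RV P >-> point}.
Implicit Types (J : {set 'I_n}) (G : set Omega) (A : 'I_n -> set point) (i : 'I_n).

Definition cylinder J G : Prop :=
  exists2 A : 'I_n -> set point, (forall i, measurable (A i)) &
    G = \bigcap_(i in [set` J]) (X i @^-1` A i).

Lemma cylinder_set0 : cylinder finset.set0 setT.
Proof.
by exists (fun=> setT) => //; apply/esym/seteqP; split.
Qed.

Lemma measurable_cylinder J G : cylinder J G -> measurable G.
Proof.
by move=> [A mA ->]; apply: fin_bigcap_measurable => // i _; exact: measurable_funPTI.
Qed.

Let bigcap_setU1 J A i B : i \notin J ->
  \bigcap_(k in [set` J]) (X k @^-1` A k) `&` X i @^-1` B =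
  \bigcap_(k in [set` (i |: J)%SET]) (X k @^-1` [eta A with i |-> B] k).
Proof.
move=> iJ; apply/seteqP; split => [w [Jw iw] k|w iJw].
  by rewrite /= !inE; case: eqP => [->//|_ /= kJ]; exact: Jw.
split; last by have := iJw i; rewrite /= !inE eqxx; exact.
move=> k kJ; have := iJw k; rewrite /= !inE (kJ : k \in J) orbT => /(_ isT).
by case: eqP kJ => // -> /=; rewrite (negbTE iJ).
Qed.

Lemma cylinder_setU1 J G i B : i \notin J -> measurable B -> cylinder J G ->
  cylinder (i |: J)%SET (G `&` X i @^-1` B).
Proof.
move=> iJ mB [A mA ->]; exists [eta A with i |-> B]; last exact: bigcap_setU1.
by move=> k /=; case: ifP.
Qed.

Lemma cylinder_independent_law J G i : mutually_independent X -> i \notin J ->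
  cylinder J G -> independent_law P G (X i) (distribution P (X i)).
Proof.
move=> indX iJ [A mA ->] B mB; rewrite bigcap_setU1// !indX//; last first.
  by move=> k /=; case: ifP.
rewrite big_setU1//= eqxx muleC; congr (_ * _)%E.
by apply: eq_bigr => k kJ; case: eqP kJ => // ->; rewrite (negbTE iJ).
Qed.

Lemma cylinder_independent_law_pair {d' : measure_display} {T : measurableType d'}
    J i (Z : Omega -> T) (m : probability T R) :
  mutually_independent X -> i \notin J -> measurable_fun setT Z ->
  (forall G, cylinder (i |: J)%SET G -> independent_law P G Z m) ->
  forall G, cylinder J G ->
  independent_law P G (fun w => (X i w, Z w)) (distribution P (X i) \x m)%E.
Proof.
move=> indX iJ mZ ZJ G GJ; apply: independent_law_pair => //.
- exact: measurable_cylinder GJ.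
- exact: (cylinder_independent_law indX iJ GJ).
- by move=> B mB; apply: ZJ; exact: cylinder_setU1.
Qed.

Lemma joint_law4 i j k l : mutually_independent X -> uniq [:: i; j; k; l] ->
  independent_law P setT (fun w => (X i w, (X j w, (X k w, X l w))))
    (distribution P (X i) \x (distribution P (X j) \x
      (distribution P (X k) \x distribution P (X l))))%E.
Proof.
move=> indX; rewrite /= !inE !negb_or -!andbA andbT.
case/and5P => ij ik il jk /andP[jl kl].
pose law u : probability point R := distribution P (X u).
pose law_kl : probability (point * point)%type R := (law k \x law l)%E.
pose law_jkl : probability (point * (point * point))%type R := (law j \x law_kl)%E.
have mX u : measurable_fun setT (X u) by exact: measurable_funP.
apply: (cylinder_independent_law_pair (m := law_jkl) indX _ _ _ cylinder_set0).
- by rewrite finset.inE.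
- by repeat apply: measurable_fun_pair.
apply: (cylinder_independent_law_pair (m := law_kl) indX).
- by rewrite !inE orbF eq_sym.
- exact: measurable_fun_pair.
apply: (cylinder_independent_law_pair (m := law l) indX).
- by rewrite !inE orbF negb_or !(eq_sym k) jk.
- exact: mX.
move=> G; apply: cylinder_independent_law => //.
by rewrite !inE orbF !negb_or !(eq_sym l) kl jl.
Qed.

End cylinders.

Section bounded_density.
Context {R : realType} {d : nat} {disp : measure_display}
  {Omega : measurableType disp} (P : probability Omega R).

Lemma distribution_density_le (phi : R) (f : Rpoint R d -> R)
    (X : {RV P >-> Rpoint R d}) : 0 <= phi ->
  (forall p, unit_cube p -> 0 <= f p <= phi) -> has_density X f ->
  density_le phi (distribution P X) (lebesgue_tuple d).
Proof.
move=> phi0 fphi Xf A mA; rewrite Xf//.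
have mAc : measurable (A `&` unit_cube).
  by apply: measurableI => //; exact: measurable_unit_cube.
apply: (@le_trans _ _ (phi%:E * lebesgue_tuple d (A `&` unit_cube))%E); last first.
  by rewrite lee_wpmul2l ?lee_fin// le_measure ?inE.
by apply: ge0_integral_le_cst => // p [_ /fphi]; rewrite !lee_fin.
Qed.

Lemma distribution_outside_cube (f : Rpoint R d -> R)
    (X : {RV P >-> Rpoint R d}) : has_density X f ->
  P (X @^-1` ~` unit_cube) = 0%E.
Proof.
move=> Xf; have := Xf (~` unit_cube) (measurableC (@measurable_unit_cube R d)).
by rewrite setICl integral_set0.
Qed.

End bounded_density.

Section small_gain_probability.
Context {R : realType} {n d : nat} {disp : measure_display}
  {Omega : measurableType disp} (P : probability Omega R).
Local Notation point := (Rpoint R (d + 2)).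
Local Notation lambda := (@lebesgue_tuple R (d + 2)).

Lemma small_gain_probability_le (phi : R) (f : 'I_n -> point -> R)
    (X : 'I_n -> {RV P >-> point}) (v1 u2 u1 v2 : 'I_n) (eps : R) (J : nat) :
  0 <= phi -> perturbed_instance phi f X -> uniq [:: v1; u2; u1; v2] ->
  0 < eps -> 1 <= eps * J%:R ->
  (P [set w | small_gain eps (X v1 w, (X u2 w, (X u1 w, X v2 w)))] <=
   (phi ^+ 3 * (25 * @pair_constant R d eps J))%:E)%E.
Proof.
move=> phi0 [_ fphi fX indX] uX eps0 Jeps.
have law_le u : density_le phi (distribution P (X u)) lambda.
  exact: (distribution_density_le phi0 (fphi u)).
have C0 : 0 <= 25 * @pair_constant R d eps J.
  by rewrite mulr_ge0// ltW// pair_constant_gt0.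
have := joint_law4 indX uX (measurable_small_gain (d := d) eps).
rewrite setTI probability_setT mul1e => ->.
rewrite -[leRHS]mule1.
rewrite -[X in (_ * X)%E](@probability_setT _ _ _ (distribution P (X v1))).
apply: ge0_integral_le_cst => [||b _] //.
  by rewrite lee_fin mulr_ge0// exprn_ge0.
apply/andP; split; first by apply: integral_ge0 => a _; exact: integral_ge0.
rewrite (_ : phi ^+ 3 = phi * (phi * phi)); last by ring.
apply: small_gain_section_le => //; [exact: mulr_ge0|exact: law_le|].
exact: (density_le_prod phi0 phi0 (law_le u1) (law_le v2)).
Qed.

End small_gain_probability.

(** * Tours *)

Section finite_sets.
Context {T : finType}.

Lemma set2_eq (a b c e : T) : [set a; b]%SET = [set c; e]%SET ->
  (a = c /\ b = e) \/ (a = e /\ b = c).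
Proof.
move=> /setP E; move: (E a) (E b) (E c) (E e); rewrite !inE !eqxx ?orbT.
move=> /esym/orP[]/eqP ac /esym/orP[]/eqP bc /orP[]/eqP ca /orP[]/eqP ea;
  by subst; auto.
Qed.

Lemma sum_set2 (V : nmodType) (F : T -> V) (a b : T) : a != b ->
  \sum_(i in [set a; b]%SET) F i = F a + F b.
Proof. by move=> ab; rewrite big_setU1 ?inE//= big_set1. Qed.

Lemma sum_setDU (V : zmodType) (F : T -> V) (A S S' : {set T}) : S \subset A ->
  {in S', forall i, i \notin A} ->
  \sum_(i in (A :\: S :|: S')%SET) F i =
  \sum_(i in A) F i - \sum_(i in S) F i + \sum_(i in S') F i.
Proof.
move=> SA S'A; rewrite [\sum_(i in A) F i](big_setID S)/= (finset.setIidPr SA).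
rewrite [X in _ = X - _ + _]addrC addrK [RHS]addrC (big_setID S')/=; congr (_ + _).
  by apply: eq_bigl => i; rewrite !inE andbC orbC; case: (i \in S').
apply: eq_bigl => i; rewrite !inE; case: (boolP (i \in S')) => [/S'A/negbTE->|_].
  by rewrite andbF.
by rewrite orbF.
Qed.

End finite_sets.

Section tour_edges.
Context {n : nat}.
Implicit Types (t : @tour n) (u v : 'I_n).

Lemma mem_tour t u : u \in tour_tuple t.
Proof.
have := uniq_min_size (tour_uniq t) (s2 := enum 'I_n).
rewrite -cardE card_ord [X in (_ <= X)%N]size_tuple leqnn.
by move=> /(_ _ isT)[v|_ ->]; rewrite mem_enum.
Qed.

Lemma next_tour_inj t : injective (next t).
Proof. exact: (can_inj (prev_next (tour_uniq t))). Qed.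

Lemma order_next_tour t u : fingraph.order (next t) u = n.
Proof.
have := order_cycle (cycle_next (tour_uniq t)) (tour_uniq t) (mem_tour t u).
by rewrite size_tuple.
Qed.

Lemma next_next_tour_neq t u : (2 < n)%N -> next t (next t u) != u.
Proof.
move=> n2; have := orbit_uniq (next t) u; rewrite /orbit order_next_tour.
case: n n2 t u => [|[|[|m]]]// _ t u /=.
by rewrite !inE !negb_or (eq_sym _ u) => /andP[/and3P[]].
Qed.

Lemma tour_edge_inj t : (2 < n)%N -> injective (fun u => [set u; next t u]%SET).
Proof.
move=> n2 u v /set2_eq[[]//|[uv vu]].
by have := next_next_tour_neq t v n2; rewrite -uv vu eqxx.
Qed.

Lemma mem_tour_edges t u : [set u; next t u]%SET \in tour_edges t.
Proof. by apply/imsetP; exists u. Qed.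

Lemma chord_notin_tour_edges t u v : next t u != v -> next t v != u ->
  [set u; v]%SET \notin tour_edges t.
Proof.
move=> uv vu; apply/imsetP => -[z _ /set2_eq[[uz vz]|[uz vz]]].
  by rewrite vz uz eqxx in uv.
by rewrite uz vz eqxx in vu.
Qed.

End tour_edges.

Section tour_length.
Context {R : realType} {n d : nat}.
Variable x : 'I_n -> Rpoint R d.
Implicit Types (t : @tour n) (e : {set 'I_n}) (u v : 'I_n).

Lemma dist2xx (p : Rpoint R d) : dist2 p p = 0.
Proof. by rewrite /dist2 big1 ?sqrtr0// => j _; rewrite subrr expr0n. Qed.

Definition edge_length e : R :=
  (\sum_(u in e) \sum_(v in e) dist2 (x u) (x v)) / 2.

Lemma edge_lengthE u v : edge_length [set u; v]%SET = dist2 (x u) (x v).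
Proof.
rewrite /edge_length; have [->|uv] := eqVneq u v.
  by rewrite finset.setUid !big_set1 dist2xx mul0r.
by rewrite !sum_set2// !dist2xx add0r addr0 (dist2C (x v)); field.
Qed.

Lemma tour_lengthE t : (2 < n)%N ->
  tour_length x t = \sum_(e in tour_edges t) edge_length e.
Proof.
move=> n2; rewrite /tour_edges big_imset/=; last first.
  by move=> u v _ _; exact: tour_edge_inj.
by apply: eq_big => // u _; rewrite edge_lengthE.
Qed.

Lemma tour_length_ge0 t : 0 <= tour_length x t.
Proof. by apply: sumr_ge0 => u _; exact: sqrtr_ge0. Qed.

Lemma tour_length_le t : (forall i, unit_cube (x i)) ->
  tour_length x t <= n%:R * Num.sqrt d%:R.
Proof.
move=> x01; rewrite [leRHS](_ : _ = \sum_(u < n) Num.sqrt d%:R); last first.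
  by rewrite sumr_const card_ord mulr_natl.
by apply: ler_sum => u _; exact: dist2_cube_le.
Qed.

Lemma two_change_tour_length t t' : two_change t t' ->
  exists u1 u2 v1 v2, uniq [:: u1; u2; v1; v2] /\
  tour_length x t - tour_length x t' =
    two_change_gain (x u1) (x u2) (x v1) (x v2).
Proof.
case/existsP => u1 /existsP[u2 /existsP[v1 /existsP[v2]]].
case/and4P => uq /eqP nu /eqP nv /eqP edges'; exists u1, u2, v1, v2; split=> //.
have n2 : (2 < n)%N.
  rewrite -(card_ord n); apply: leq_trans (max_card (mem [:: u1; u2; v1; v2])).
  by rewrite (card_uniqP uq).
move: uq; rewrite /= !inE !negb_or -!andbA andbT.
case/and5P => u12 u1v1 u1v2 u2v1 /andP[u2v2 v12].
rewrite !tour_lengthE// edges' sum_setDU.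
- rewrite !sum_set2 ?edge_lengthE /two_change_gain; first by ring.
  + by apply/eqP => /set2_eq[[]|[]] /eqP; rewrite ?(negbTE u12) ?(negbTE u1v2).
  + by apply/eqP => /set2_eq[[]|[]] /eqP; rewrite ?(negbTE u1v1) ?(negbTE u1v2).
- apply/fintype.subsetP => e; rewrite !inE => /orP[]/eqP->.
    by rewrite -nu mem_tour_edges.
  by rewrite -nv mem_tour_edges.
- move=> e; rewrite !inE => /orP[]/eqP->; apply: chord_notin_tour_edges.
  + by rewrite nu.
  + by rewrite nv eq_sym.
  + by rewrite -nv (inj_eq (@next_tour_inj _ t)).
  + by rewrite -nu (inj_eq (@next_tour_inj _ t)) eq_sym.
Qed.

End tour_length.

Section two_opt_runs.
Context {R : realType} {n d : nat}.
Variable x : 'I_n -> Rpoint R d.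

Lemma path_average_step (T : Type) (e : rel T) (f : T -> R) (t : T) (r : seq T) :
  (0 < size r)%N -> path e t r ->
  exists s s', e s s' /\ (f s - f s') * (size r)%:R <= f t - f (last t r).
Proof.
elim: r t => // s [_ t _ /= /andP[ts _]|s' r IH t _ /= /andP[ts /(IH s isT)]].
  by exists t, s; rewrite mulr1.
case=> [a [b [ab gain_le]]]; rewrite -[(size r).+2%:R]natr1.
have [small|/ltW large] := leP (f t - f s) (f a - f b).
  exists t, s; split=> //; rewrite mulrDr mulr1.
  by have := ler_wpM2r (ler0n R (size r).+1) small; move: gain_le => /=; lra.
by exists a, b; split=> //; rewrite mulrDr mulr1; move: gain_le => /=; lra.
Qed.

Lemma path_improving_size (t : @tour n) (r : seq tour) :
  path (improving x) t r -> (size r <= n ^ n)%N.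
Proof.
move=> ptr; pose len (s : n.-tuple 'I_n) : R := \sum_(u < n) dist2 (x u) (x (next s u)).
have dec : sorted >%R (map len (map (@tour_tuple n) r)).
  apply: (@path_sorted _ _ (tour_length x t)); rewrite -map_comp path_map.
  by apply: sub_path ptr => s s' /andP[].
have uniq_r : uniq (map (@tour_tuple n) r).
  exact: map_uniq (sorted_uniq (rev_trans lt_trans) ltxx dec).
rewrite -(size_map (@tour_tuple n)) -(card_uniqP uniq_r).
by apply: leq_trans (max_card _) _; rewrite card_tuple card_ord.
Qed.

Definition gain_threshold (k : nat) : R := n%:R * Num.sqrt d%:R / k.+1%:R.

Local Notation quad := ('I_n * 'I_n * 'I_n * 'I_n)%type.

Definition distinct4 (q : quad) : bool :=
  let: (u1, u2, v1, v2) := q in uniq [:: u1; u2; v1; v2].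

Definition quad_gain (q : quad) : R :=
  let: (u1, u2, v1, v2) := q in two_change_gain (x u1) (x u2) (x v1) (x v2).

Hypothesis x01 : forall i, unit_cube (x i).

Lemma exists_small_gain (t : @tour n) (r : seq tour) (k : nat) :
  path (improving x) t r -> (k < size r)%N ->
  exists2 q, distinct4 q & 0 < quad_gain q <= gain_threshold k.
Proof.
move=> ptr kr; have r0 : (0 < size r)%N by exact: leq_ltn_trans kr.
have [s [s' [/andP[ss' lt_len] gain_le]]] := path_average_step (tour_length x) r0 ptr.
have [u1 [u2 [v1 [v2 [uq gainE]]]]] := two_change_tour_length x ss'.
exists (u1, u2, v1, v2) => //=; rewrite -gainE subr_gt0 lt_len/= ler_pdivlMr//.
apply: (@le_trans _ _ ((tour_length x s - tour_length x s') * (size r)%:R)).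
  by rewrite ler_wpM2l ?ler_nat// subr_ge0 ltW.
apply: le_trans gain_le (le_trans _ (tour_length_le t x01)).
by rewrite lerBlDr lerDl tour_length_ge0.
Qed.

Lemma improving_path_size_le (t : @tour n) (r : seq tour) :
  path (improving x) t r ->
  (size r <= \sum_(k < n ^ n) \sum_(q : quad | distinct4 q)
     (0 < quad_gain q <= gain_threshold k)%R)%N.
Proof.
move=> ptr; pose count k := (\sum_(q : quad | distinct4 q)
  (0 < quad_gain q <= gain_threshold k)%R)%N.
rewrite -(big_mkord xpredT count) (big_cat_nat _ (path_improving_size ptr))//=.
apply: leq_trans (leq_addr _ _); rewrite -[leqLHS](subn0) -[leqLHS]muln1.
rewrite -sum_nat_const_nat big_nat [leqRHS]big_nat; apply: leq_sum => k /andP[_ kr].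
have [q dq gq] := exists_small_gain ptr kr.
by rewrite /count (bigD1 q)//= gq.
Qed.

End two_opt_runs.

(** * The expected number of steps *)

Section expectation.
Context {R : realType} {n d : nat} {disp : measure_display}
  {Omega : measurableType disp} (P : probability Omega R).
Local Notation point := (Rpoint R (d + 2)).
Local Notation quad := ('I_n * 'I_n * 'I_n * 'I_n)%type.
Local Notation N := (n ^ n)%N.
Local Notation threshold := (@gain_threshold R n (d + 2)).
Local Notation S := (Num.sqrt (d + 2)%:R : R).
Local Notation H := (series (@harmonic R) N).
Variables (phi : R) (f : 'I_n -> point -> R) (X : 'I_n -> {RV P >-> point}).
Hypotheses (phi0 : 0 <= phi) (pX : perturbed_instance phi f X).

Definition small_gain_event (eps : R) (q : quad) : set Omega :=
  let: (u1, u2, v1, v2) := q in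
  [set w | small_gain eps (X v1 w, (X u2 w, (X u1 w, X v2 w)))].

Lemma measurable_small_gain_event eps q : measurable (small_gain_event eps q).
Proof.
case: q => [[[u1 u2] v1] v2].
have mX u : measurable_fun setT (X u) by exact: measurable_funP.
apply: measurable_preimageT (measurable_small_gain _).
by repeat apply: measurable_fun_pair.
Qed.

Lemma ae_unit_cube : {ae P, forall w, forall i, unit_cube (X i w)}.
Proof.
have [_ _ fX _] := pX; apply: filter_forall => i; exists (X i @^-1` ~` unit_cube).
split=> //; last exact: (distribution_outside_cube (fX i)).
by apply: measurable_funPTI; apply: measurableC; exact: measurable_unit_cube.
Qed.

Lemma two_opt_steps_ae_le : {ae P, forall w,
  (two_opt_steps (fun i => X i w) <= \sum_(k < N) \sum_(q : quad | distinct4 q)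
    (\1_(small_gain_event (threshold k) q) w)%:E)%E}.
Proof.
apply: filterS ae_unit_cube => w X01.
apply: ge_ereal_sup => _ [t [r [[ptr _] ->]]].
have := improving_path_size_le X01 ptr; rewrite -(ler_nat R) -lee_fin.
move=> /le_trans; apply; rewrite natr_sum -sumEFin; apply: lee_sum => k _.
rewrite natr_sum -sumEFin; apply: lee_sum => -[[[u1 u2] v1] v2] _.
rewrite lee_fin indicE ler_nat; case: (boolP (_ < _ <= _)) => // gain_small.
by rewrite mem_set//; split.
Qed.

Lemma expected_two_opt_steps_le :
  (\int[P]_w two_opt_steps (fun i => X i w) <=
   \sum_(k < N) \sum_(q : quad | distinct4 q)
     P (small_gain_event (threshold k) q))%E.
Proof.
have mind k q : measurable_fun setT (fun w =>
    (\1_(small_gain_event (threshold k) q) w)%:E : \bar R).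
  exact/measurable_EFinP/measurable_indic/measurable_small_gain_event.
have msum k : measurable_fun setT (fun w => \sum_(q : quad | distinct4 q)
    (\1_(small_gain_event (threshold k) q) w)%:E : \bar R)%E.
  by under eq_fun do rewrite -big_filter; apply: emeasurable_sum => q; exact: mind.
apply: (le_trans (ae_le_ge0_integral _ _ two_opt_steps_ae_le)).
- by apply: emeasurable_sum => k; exact: msum.
- by move=> w; apply: sume_ge0 => k _; apply: sume_ge0.
rewrite ge0_integral_sum//; last by move=> k w _; apply: sume_ge0.
apply: lee_sum => k _; under eq_integral do rewrite -big_filter.
rewrite ge0_integral_sum// big_filter; apply: lee_sum => q _.
by rewrite integral_indicT//; exact: measurable_small_gain_event.
Qed.

Lemma small_gain_event_probability_le (k : 'I_N) (q : quad) :
  (0 < n)%N -> distinct4 q ->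
  (P (small_gain_event (threshold k) q) <=
   (phi ^+ 3 * (25 * @pair_constant R d (threshold k) N))%:E)%E.
Proof.
case: q => [[[u1 u2] v1] v2] n0 uq; have S0 := @sqrt_dim_ge1 R d.
apply: (small_gain_probability_le phi0 pX).
- rewrite (perm_uniq (s2 := [:: u1; u2; v1; v2]))//.
  by apply/permP => a /=; ring.
- by rewrite divr_gt0// mulr_gt0 ?ltr0n// (lt_le_trans ltr01 S0).
rewrite /gain_threshold mulrAC ler_pdivlMr// mul1r -[leLHS]mul1r ler_pM ?ler_nat//.
by rewrite -[leLHS]mulr1 ler_pM// ler1n.
Qed.

Lemma card_distinct4_le : (#|[pred q : quad | distinct4 q]| <= n ^ 4)%N.
Proof. by rewrite (leq_trans (max_card _))// !card_prod card_ord -!mulnA. Qed.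

Lemma expected_two_opt_steps_harmonic_le : (0 < n)%N ->
  (\int[P]_w two_opt_steps (fun i => X i w) <=
   (700 * (d + 2)%:R ^+ 2 * phi ^+ 3 * n%:R ^+ 5 * (H * (1 + 14 * H)))%:E)%E.
Proof.
move=> n0; apply: (le_trans expected_two_opt_steps_le).
rewrite (_ : (d + 2)%:R = S ^+ 2); last by rewrite sqr_sqrtr.
pose C k := phi ^+ 3 * (25 * @pair_constant R d (threshold k) N).
have C0 k : 0 <= C k.
  have H0 := @series_harmonic_ge0 R N.
  by rewrite !mulr_ge0 ?exprn_ge0 ?sqrtr_ge0// addr_ge0// mulr_ge0.
apply: (@le_trans _ _ (\sum_(k < N) (n%:R ^+ 4 * C k)%:E)%E).
  apply: lee_sum => k _.
  apply: (@le_trans _ _ (\sum_(q : quad | distinct4 q) (C k)%:E)%E).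
    by apply: lee_sum => q dq; exact: small_gain_event_probability_le.
  rewrite sumEFin sumr_const lee_fin -[leLHS]mulr_natl ler_wpM2r// -natrX ler_nat.
  exact: card_distinct4_le.
rewrite sumEFin lee_fin le_eqVlt; apply/orP; left; apply/eqP.
rewrite [in RHS](_ : H * _ = (1 + 14 * H) * H); last by rewrite mulrC.
rewrite /C /pair_constant /gain_threshold; move: (1 + 14 * H) => h.
by rewrite /series/= big_mkord !mulr_sumr; apply: eq_bigr => k _ /=; ring.
Qed.

Lemma expected_two_opt_steps_le0 : (n < 4)%N ->
  (\int[P]_w two_opt_steps (fun i => X i w) <= 0)%E.
Proof.
move=> n4; apply: (le_trans expected_two_opt_steps_le).
rewrite big1// => k _; rewrite big1// => -[[[u1 u2] v1] v2] /card_uniqP uq.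
by have := max_card (mem [:: u1; u2; v1; v2]); rewrite uq card_ord leqNgt n4.
Qed.

End expectation.

Lemma series_harmonic_expnn_le (R : realType) (n : nat) : (1 < n)%N ->
  series (@harmonic R) (n ^ n)%N * (1 + 14 * series harmonic (n ^ n)%N) <=
  58 * (n%:R * ln n%:R) ^+ 2.
Proof.
move=> n1; set H := series _ _; have n0 : 0 < n%:R :> R by rewrite ltr0n ltnW.
set l := _ * ln _; have l1 : 1 <= l.
  apply: le_trans (ler_wpM2l (ltW n0) (subr1V_le_ln n0)).
  by rewrite mulrBr mulr1 divff ?gt_eqF// lerBrDr (ler_nat R 2).
have Hl : H <= 1 + l.
  rewrite /l mulr_natl -lnXn// -natrX.
  by apply: series_harmonic_le; rewrite expn_gt0 ltnW.
have H0 : 0 <= H by exact: series_harmonic_ge0.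
by nra.
Qed.

Theorem theorem6 (R : realType) (d : nat) (hd : (2 <= d)%N) :
  exists C : R, forall (n : nat) (phi : R), (0 < n)%N -> 1 <= phi ->
    forall (disp : measure_display) (Omega : measurableType disp)
      (P : probability Omega R)
      (f : 'I_n -> Rpoint R d -> R) (X : 'I_n -> {RV P >-> Rpoint R d}),
    perturbed_instance phi f X ->
    (\int[P]_w two_opt_steps (fun i => X i w)
       <= (C * n%:R ^+ 7 * ln n%:R ^+ 2 * phi ^+ 3)%:E)%E.
Proof.
rewrite -(subnK hd); move: (d - 2)%N => {hd}d.
have K0 : 0 <= 700 * (d + 2)%:R ^+ 2 :> R.
  by exact: mulr_ge0 (ler0n _ _) (sqr_ge0 _).
have := @expected_two_opt_steps_harmonic_le R _ d.
move: (700 * _) K0 => K K0 steps_le.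
exists (58 * K) => n phi n0 phi1 disp Omega P f X pX.
have phi0 : 0 <= phi by exact: le_trans phi1.
have [n4|n4] := ltnP n 4.
  apply: (le_trans (expected_two_opt_steps_le0 pX n4)); rewrite lee_fin.
  by rewrite !mulr_ge0 ?exprn_ge0 ?ln_ge0 ?ler1n.
apply: (le_trans (steps_le _ _ _ _ _ _ _ phi0 pX n0)); rewrite lee_fin.
rewrite [leRHS](_ : _ =
  K * phi ^+ 3 * n%:R ^+ 5 * (58 * (n%:R * ln n%:R) ^+ 2)); last by ring.
rewrite ler_wpM2l ?(mulr_ge0, exprn_ge0)//.
by apply: series_harmonic_expnn_le; exact: leq_trans n4.
Qed.
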